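(* Let $M$ be a transitive model of $\mathsf{ZF}$ and let $\mathcal{X}=\langle x_n : n\in\omega\rangle$ be a sequence of elements of ${}^\omega\omega$. Suppose $\mathcal{W}=\langle\mathcal{F},I\rangle\in M$ is a shrink wrapper for $\mathcal{X}$. Then there is a Borel function $g:{}^\omega\omega\to{}^\omega\omega$ that has a Borel code in $M$ such that for every $x\in{}^\omega\omega$, $f_{\mathcal{X}}(x)\le^* g(x)$, i.e. $f_{\mathcal{X}}(x)(n)\le g(x)(n)$ for all but finitely many $n$.
   Context: For a sequence of reals $\mathcal{X}=\langle x_n:n\in\omega\rangle$, $f_{\mathcal{X}}:{}^\omega\omega\to{}^\omega\omega$ is defined by $f_{\mathcal{X}}(x)(n)=\min\{l : x(l)\ne x_n(l)\}$ if $x\ne x_n$, and $f_{\mathcal{X}}(x)(n)=0$ otherwise. A function $f:\omega\to\omega\setminus\{0\}$ is given. A tree $T \subseteq {}^{<\omega}\omega$ obeys $f$ if for each $l\in\omega$ the set $\{n\in\omega : t^\frown n\in T \text{ for some } t \text{ on level } l \text{ of } T\}$ has size at most $f(l)$. Fixed throughout: a sequence $\langle f_i : i<\omega\rangle$ of functions $f_i:\omega\to\omega\setminus\{0\}$ such that $(i,l)\mapsto f_i(l)$ is computable and finite-to-one; a computable bijection $\eta:\omega\to[\omega]^2$; and a finite-to-one function $\Phi:{}^{<\omega}2\times\omega\to\omega$ (in $M$). A shrink wrapper for $\mathcal{X}$ is a pair $\langle\mathcal{F},I\rangle$ where $I:\omega\to[{}^\omega\omega]^{<\omega}$ and $\mathcal{F}$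 is a family of functions $F_{\tilde n,n}$ for $\tilde n\in\omega$, $n\in\eta(\tilde n)$, such that: 1) $F_{\tilde n,n}:{}^{\tilde n}2\to\mathcal{P}({}^{<\omega}\omega)$ and for each $s\in{}^{\tilde n}2$, $F_{\tilde n,n}(s)$ is a leafless tree obeying $f_{\Phi(s,n)}$; 2) for each $\tilde n$ and $n\in\eta(\tilde n)$ there is $s\in{}^{\tilde n}2$ with $x_n\in[F_{\tilde n,n}(s)]$; 3) for $\{n_1,n_2\}=\eta(\tilde n)$ and all $s_1,s_2\in{}^{\tilde n}2$, letting $C_1=[F_{\tilde n,n_1}(s_1)]$ and $C_2=[F_{\tilde n,n_2}(s_2)]$, one of the following holds: (a) $C_1=C_2$, and if $x_{n_1}\in C_1$ or $x_{n_2}\in C_2$ then $x_{n_1}=x_{n_2}$; (b) there is $x\in I(n_1)\cap I(n_2)$ with $C_1=C_2=\{x\}$; (c) $C_1\cap C_2=\emptyset$. Here $[T]$ denotes the set of infinite branches of $T$. *)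

(* Defs.v *)
From mathcomp Require Import all_boot finmap.
From mathcomp Require Import boolp classical_sets functions cardinality filter.
From mathcomp Require Import topology measurable_structure.

Set Implicit Arguments.
Unset Strict Implicit.
Unset Printing Implicit Defensive.

Local Open Scope classical_set_scope.
Local Open Scope nat_scope.

(** * The ambient universe of sets

   Aczel's iterative sets.  Equality of sets is [veq] (extensional equality),
   not Leibniz equality; [sup A f] is the set of all [f a], [a : A]. *)

Inductive V : Type := sup (A : Type) (f : A -> V).

Fixpoint veq (x y : V) : Prop :=
  let: sup A f := x in let: sup B g := y in
  (forall a, exists b, veq (f a) (g b)) /\ (forall b, exists a, veq (f a) (g b)).

Definition vin (x y : V) : Prop := let: sup B g := y in exists b, veq x (g b).

(** * First-order formulas of set theory (de Bruijn indices) *)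

Inductive formula :=
| FIn (i j : nat)
| FEq (i j : nat)
| FNot (p : formula)
| FAnd (p q : formula)
| FAll (p : formula).

Definition scons (a : V) (rho : nat -> V) (i : nat) : V :=
  if i is j.+1 then rho j else a.

(* (M, vin) |= p [rho] *)
Fixpoint sat (M : V -> Prop) (rho : nat -> V) (p : formula) : Prop :=
  match p with
  | FIn i j => vin (rho i) (rho j)
  | FEq i j => veq (rho i) (rho j)
  | FNot q => ~ sat M rho q
  | FAnd q r => sat M rho q /\ sat M rho r
  | FAll q => forall a, M a -> sat M (scons a rho) q
  end.

(* [M] may be a set or a proper class.  Each single axiom is written out as its
   relativization to [M]; in the schemas the values of [rho] are the
   parameters of the formula [p]. *)
Record models_ZF (M : V -> Prop) : Prop := ModelsZF {
  zf_extensionality : forall x y, M x -> M y ->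
    (forall z, M z -> (vin z x <-> vin z y)) -> veq x y;
  zf_foundation : forall x, M x -> (exists2 y, M y & vin y x) ->
    exists y, [/\ M y, vin y x & ~ exists z, [/\ M z, vin z x & vin z y]];
  zf_pairing : forall x y, M x -> M y ->
    exists2 z, M z & forall w, M w -> (vin w z <-> veq w x \/ veq w y);
  zf_union : forall x, M x ->
    exists2 u, M u &
      forall z, M z -> (vin z u <-> exists y, [/\ M y, vin y x & vin z y]);
  zf_powerset : forall x, M x ->
    exists2 p, M p &
      forall y, M y -> (vin y p <-> forall z, M z -> vin z y -> vin z x);
  zf_infinity : exists w,
    [/\ M w,
        exists e, [/\ M e, vin e w & forall z, M z -> ~ vin z e] &
        forall x, M x -> vin x w ->
          exists y, [/\ M y, vin y w &
            forall z, M z -> (vin z y <-> vin z x \/ veq z x)]];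
  zf_separation : forall (p : formula) (rho : nat -> V) a,
    (forall i, M (rho i)) -> M a ->
    exists2 b, M b &
      forall x, M x -> (vin x b <-> vin x a /\ sat M (scons x rho) p);
  zf_replacement : forall (p : formula) (rho : nat -> V) a,
    (forall i, M (rho i)) -> M a ->
    (forall x y z, M x -> M y -> M z -> vin x a ->
       sat M (scons x (scons y rho)) p -> sat M (scons x (scons z rho)) p ->
       veq y z) ->
    exists2 b, M b &
      forall y, M y -> (vin y b <->
        exists x, [/\ M x, vin x a & sat M (scons x (scons y rho)) p])
}.

(* [tm_ext] only says that [M] is a class of sets up to [veq]. *)
Record transitive_model_ZF (M : V -> Prop) : Prop := TransitiveModelZF {
  tm_ext : forall x y, veq x y -> M x -> M y;
  tm_transitive : forall x y, M x -> vin y x -> M y;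
  tm_ZF : models_ZF M
}.

(** * Concrete objects as sets *)

Definition vempty : V := sup (of_void V).

Definition vsucc (x : V) : V :=
  let: sup A f := x in sup (fun o : option A => if o is Some a then f a else x).

Fixpoint vnat (n : nat) : V := if n is m.+1 then vsucc (vnat m) else vempty.

Definition vupair (x y : V) : V := sup (fun b : bool => if b then x else y).

Definition vpair (x y : V) : V := vupair (vupair x x) (vupair x y).

(* The function { (d a, v a) | a : A }, for [d] injective up to [veq]. *)
Definition vfun (A : Type) (d v : A -> V) : V :=
  sup (fun a => vpair (d a) (v a)).

Definition vseq (s : seq nat) : V :=
  vfun (fun i : 'I_(size s) => vnat i) (fun i => vnat (nth 0 s i)).

Definition vbits (s : seq bool) : V := vseq (map nat_of_bool s).

Definition vreal (x : nat -> nat) : V := vfun vnat (fun n => vnat (x n)).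

Definition vtree (T : set (seq nat)) : V :=
  sup (fun t : {t : seq nat | T t} => vseq (sval t)).

Definition vreals (A : set (nat -> nat)) : V :=
  sup (fun x : {x : nat -> nat | A x} => vreal (sval x)).

Definition vPhi (Phi : seq bool * nat -> nat) : V :=
  vfun (fun p : seq bool * nat => vpair (vbits p.1) (vnat p.2))
       (fun p => vnat (Phi p)).

(** * Computable functions

   The class of total recursive functions: minimization is only applied to
   functions for which it is everywhere defined. *)

Inductive recursive : forall k, (k.-tuple nat -> nat) -> Prop :=
| rec_zero k : @recursive k (fun=> 0)
| rec_succ : @recursive 1 (fun v => (thead v).+1)
| rec_proj k (i : 'I_k) : @recursive k (fun v => tnth v i)
| rec_comp k m (f : m.-tuple nat -> nat) (g : 'I_m -> k.-tuple nat -> nat) :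
    recursive f -> (forall i, recursive (g i)) ->
    @recursive k (fun v => f [tuple g i v | i < m])
| rec_prim k (f : k.-tuple nat -> nat) (g : k.+2.-tuple nat -> nat)
    (h : k.+1.-tuple nat -> nat) :
    recursive f -> recursive g ->
    (forall v : k.-tuple nat, h [tuple of 0 :: v] = f v) ->
    (forall n (v : k.-tuple nat),
       h [tuple of n.+1 :: v] = g [tuple of n :: h [tuple of n :: v] :: v]) ->
    recursive h
| rec_min k (f : k.+1.-tuple nat -> nat) (h : k.-tuple nat -> nat) :
    recursive f ->
    (forall v : k.-tuple nat, f [tuple of h v :: v] = 0) ->
    (forall (v : k.-tuple nat) m, m < h v -> f [tuple of m :: v] <> 0) ->
    recursive h.

Definition computable1 (f : nat -> nat) : Prop :=
  recursive (fun v : 1.-tuple nat => f (tnth v ord0)).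

Definition computable2 (f : nat -> nat -> nat) : Prop :=
  recursive (fun v : 2.-tuple nat => f (tnth v ord0) (tnth v ord_max)).

Definition finite_to_one (A : Type) (f : A -> nat) : Prop :=
  forall k, finite_set (f @^-1` [set k]).

(* [omega]^2: the two-element subsets of omega *)
Definition pairs := {A : {fset nat} | #|` A| == 2}.

Definition computable_pairs (eta : nat -> pairs) : Prop :=
  exists a b : nat -> nat,
    [/\ computable1 a, computable1 b & forall k, val (eta k) = [fset a k; b k]%fset].

(** * Trees and shrink wrappers *)

Definition is_tree (T : set (seq nat)) : Prop :=
  forall s t, prefix s t -> T t -> T s.

Definition leafless (T : set (seq nat)) : Prop :=
  forall t, T t -> exists n, T (rcons t n).

Definition obeys (T : set (seq nat)) (f : nat -> nat) : Prop :=
  forall l, ([set n | exists t, [/\ T t, size t = l & T (rcons t n)]]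
               #<= `I_(f l))%card.

Definition branches (T : set (seq nat)) : set (nat -> nat) :=
  [set x | forall n, T (mkseq x n)].

(* [F nt n s] is the value at [s] of the function F_{nt,n}; it is meaningful
   only for [n \in eta nt]. *)
Definition wrapper_family := forall nt : nat, nat -> nt.-tuple bool -> set (seq nat).

Record shrink_wrapper (f : nat -> nat -> nat) (eta : nat -> pairs)
    (Phi : seq bool * nat -> nat) (X : nat -> nat -> nat)
    (F : wrapper_family) (I : nat -> set (nat -> nat)) : Prop := ShrinkWrapper {
  sw_finite : forall n, finite_set (I n);
  sw_tree : forall nt n, n \in val (eta nt) -> forall s : nt.-tuple bool,
    [/\ is_tree (F nt n s), leafless (F nt n s) &
        obeys (F nt n s) (f (Phi (tval s, n)))];
  sw_cover : forall nt n, n \in val (eta nt) ->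
    exists s : nt.-tuple bool, branches (F nt n s) (X n);
  sw_disjoint : forall nt n1 n2, val (eta nt) = [fset n1; n2]%fset ->
    forall s1 s2 : nt.-tuple bool,
    let C1 := branches (F nt n1 s1) in
    let C2 := branches (F nt n2 s2) in
    [\/ C1 = C2 /\ (C1 (X n1) \/ C2 (X n2) -> X n1 = X n2),
        exists x, [/\ I n1 x, I n2 x, C1 = [set x] & C2 = [set x]] |
        C1 `&` C2 = set0]
}.

(* The pair <F, I>, where F is the family of the F_{nt,n} indexed by the pairs
   (nt, n) with [n \in eta nt]. *)
Definition vwrapper (eta : nat -> pairs) (F : wrapper_family)
    (I : nat -> set (nat -> nat)) : V :=
  vpair
    (vfun (fun p : {p : nat * nat | p.2 \in val (eta p.1)} =>
             vpair (vnat (sval p).1) (vnat (sval p).2))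
          (fun p => vfun (fun s : (sval p).1.-tuple bool => vbits s)
                         (fun s => vtree (F (sval p).1 (sval p).2 s))))
    (vfun vnat (fun n => vreals (I n))).

(** * The function f_X *)

Definition fX (X : nat -> nat -> nat) (x : nat -> nat) (n : nat) : nat :=
  match pselect (exists l, x l != X n l) with
  | left h => ex_minn h
  | right _ => 0
  end.

Definition eventually_le (u v : nat -> nat) : Prop :=
  \forall n \near \oo, u n <= v n.

(** * Borel sets, Borel functions and their codes *)

Definition borel_set : set (set (nat -> nat)) :=
  <<s [set U | @open (prod_topology (fun _ : nat => nat)) U] >>.

Definition borel_fun (g : (nat -> nat) -> nat -> nat) : Prop :=
  forall B, borel_set B -> borel_set (g @^-1` B).

Definition cylinder (s : seq nat) : set (nat -> nat) :=
  [set x | mkseq x (size s) = s].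

(* Solovay's coding: [borel_code c A] says that the real [c] is a Borel code
   and that [A] is the set it codes.  The sequences of naturals are enumerated
   by the bijection [CodeSeq.decode], with inverse [CodeSeq.code]. *)
Inductive borel_code : (nat -> nat) -> set (nat -> nat) -> Prop :=
| bc_open c : 1 < c 0 ->
    borel_code c (\bigcup_(n in [set n | c n.+1 = 1]) cylinder (CodeSeq.decode n))
| bc_compl c A : c 0 = 0 ->
    borel_code (fun m => c m.+1) A -> borel_code c (~` A)
| bc_union c (A : nat -> set (nat -> nat)) : c 0 = 1 ->
    (forall i, borel_code (fun m => c (CodeSeq.code [:: i; m]).+1) (A i)) ->
    borel_code c (\bigcup_i A i).

(* A code for [g] is a real whose sections code the sets {x | g x n = k}. *)
Definition borel_fun_code (c : nat -> nat) (g : (nat -> nat) -> nat -> nat) : Prop :=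
  forall n k,
    borel_code (fun m => c (CodeSeq.code [:: n; k; m])) [set x | g x n = k].

Definition has_borel_code_in (M : V -> Prop) (g : (nat -> nat) -> nat -> nat) : Prop :=
  exists2 c, borel_fun_code c g & M (vreal c).

(* Main.v *)
Require Import Defs.
From mathcomp Require Import all_boot finmap.
From mathcomp Require Import boolp classical_sets functions cardinality filter.
From mathcomp Require Import topology measurable_structure.

(** Let g(x)(n) be the least k such that either
    (1) for some nt with n in eta(nt), the node x|k lies in none of the trees
        F_{nt,n}(s), or
    (2) no such k exists, k >= n, and for all m < n, {m,n} = eta(nt) and s, if
        x|k lies in F_{nt,n}(s) then x is a branch of F_{nt,n}(s).
    Since x_n is a branch of some F_{nt,n}(s), (1) makes x|k differ from x_n|k.
    So if k = g(x)(n) < f_X(x)(n), then we are in case (2), and for every m < n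
    the reals x and x_n are branches of a common tree C of index ({m,n},n).  If
    m is another such index, x is also a branch of a tree of index ({m,n},m),
    and the alternatives (b) and (c) for this tree and C are excluded (the
    former because x <> x_n), hence x_m = x_n.  So f_X(x) takes a single value
    at all such n, whereas g(x)(n) >= n; there are only finitely many of them.

    The sets {x | g(x)(n) = k} are Boolean combinations of open sets, uniformly
    in n and k and with codes definable over M from the shrink wrapper, so
    Replacement in M yields a code of g. *)

Set Implicit Arguments.
Unset Strict Implicit.
Unset Printing Implicit Defensive.

Local Open Scope classical_set_scope.
Local Open Scope nat_scope.

(** * Iterative sets *)

Lemma veq_refl x : veq x x.
Proof. by elim: x => A f IH /=; split=> a; exists a. Qed.

Lemma veq_sym x y : veq x y -> veq y x.
Proof.
elim: x y => A f IH [B g] /= [H1 H2]; split=> [b|a].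
  by have [a /IH] := H2 b; exists a.
by have [b /IH] := H1 a; exists b.
Qed.

Lemma veq_trans x y z : veq x y -> veq y z -> veq x z.
Proof.
elim: x y z => A f IH [B g] [C h] /= [H1 H2] [K1 K2]; split=> [a|c].
  by have [b ab] := H1 a; have [c bc] := K1 b; exists c; apply: IH bc.
by have [b bc] := K2 c; have [a ab] := H2 b; exists a; apply: IH bc.
Qed.

Lemma vin_eql x x' y : veq x x' -> vin x y -> vin x' y.
Proof.
by case: y => B g /veq_sym xx [b xb]; exists b; apply: veq_trans xb.
Qed.

Lemma vin_eqr x y y' : veq y y' -> vin x y -> vin x y'.
Proof.
case: y y' => [A f] [B g] [H _] [a xa]; have [b ab] := H a.
by exists b; apply: veq_trans ab.
Qed.

Lemma veqP x y : veq x y <-> forall z, vin z x <-> vin z y.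
Proof.
split=> [xy z|]; first by split; apply: vin_eqr => //; apply: veq_sym.
case: x y => [A f] [B g] H; split=> [a|b].
  by have [+ _] := H (f a); apply; exists a; apply: veq_refl.
have [_ []] := H (g b); first by exists b; apply: veq_refl.
by move=> a ba; exists a; apply: veq_sym.
Qed.

(** Structural induction reaches only the representatives [f a] of the members, so the claim is
    first strengthened to all sets [veq] to [x]. *)
Lemma vin_ind (P : V -> Prop) :
  (forall x, (forall y, vin y x -> P y) -> P x) -> forall x, P x.
Proof.
move=> H x; suff: forall y, veq y x -> P y by apply; apply: veq_refl.
elim: x => A f IH y yx; apply: H => z /(vin_eqr yx)[a]; exact: IH.
Qed.

Lemma vin_irr x : ~ vin x x.
Proof. by elim/vin_ind: x => x IH xx; apply: (IH x). Qed.

Lemma in_vempty z : ~ vin z vempty. Proof. by case=> -[]. Qed.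

Lemma in_vsucc z x : vin z (vsucc x) <-> vin z x \/ veq z x.
Proof.
case: x => A f; split=> [[[a|] zx]|[[a zx]|zx]].
- by left; exists a.
- by right.
- by exists (Some a).
- by exists None.
Qed.

Lemma in_vupair z x y : vin z (vupair x y) <-> veq z x \/ veq z y.
Proof.
by split=> [[[]]|[]] ?; [left | right | exists true | exists false].
Qed.

Lemma vupair_eq x y x' y' : veq x x' -> veq y y' ->
  veq (vupair x y) (vupair x' y').
Proof.
by move=> xx yy; split=> -[]; [exists true|exists false|exists true|exists false].
Qed.

Lemma vupair_inj x y z w : veq (vupair x y) (vupair z w) ->
  (veq x z /\ veq y w) \/ (veq x w /\ veq y z).
Proof.
move=> /veqP H.
have /in_vupair xzw : vin x (vupair z w) by apply/H/in_vupair; left; apply: veq_refl.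
have /in_vupair yzw : vin y (vupair z w) by apply/H/in_vupair; right; apply: veq_refl.
have /in_vupair zxy : vin z (vupair x y) by apply/H/in_vupair; left; apply: veq_refl.
have /in_vupair wxy : vin w (vupair x y) by apply/H/in_vupair; right; apply: veq_refl.
case: xzw => [xz|xw].
  case: yzw => [yz|]; last by left.
  case: wxy => [wx|wy]; last by left; split=> //; apply: veq_sym.
  left; split=> //; apply: veq_trans yz _; apply: veq_trans (veq_sym xz) _.
  exact: veq_sym.
case: yzw => [|yw]; first by right.
case: zxy => [zx|zy]; last by right; split=> //; apply: veq_sym.
left; split=> //; exact: veq_sym.
Qed.

Lemma vpair_eq x y x' y' : veq x x' -> veq y y' ->
  veq (vpair x y) (vpair x' y').
Proof. by move=> xx yy; do 2!apply: vupair_eq. Qed.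

Lemma vpair_inj x y x' y' : veq (vpair x y) (vpair x' y') ->
  veq x x' /\ veq y y'.
Proof.
move=> /vupair_inj[[/vupair_inj xx /vupair_inj yy]|[/vupair_inj xx /vupair_inj yy]].
  have {}xx : veq x x' by case: xx => -[].
  split=> //; case: yy => -[] // xy yx.
  by apply: veq_trans yx _; apply: veq_trans (veq_sym xx) _.
have [x1 x2] : veq x x' /\ veq x y' by case: xx => -[].
have [x3 x4] : veq x x' /\ veq y x' by case: yy => -[].
by split=> //; apply: veq_trans x4 (veq_trans (veq_sym x1) x2).
Qed.

(** * Codes of natural numbers and finite sequences *)

Lemma in_vnat z n : vin z (vnat n) <-> exists2 m, m < n & veq z (vnat m).
Proof.
elim: n => [|n IH] /=; first by split=> [[]|[]].
rewrite in_vsucc IH; split=> [[[m mn zm]|zn]|[m]].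
- by exists m => //; apply: leqW.
- by exists n.
- rewrite ltnS leq_eqVlt => /predU1P[->|mn zm]; first by right.
  by left; exists m.
Qed.

(** If [m < n], then [vnat m] is a member of [vnat n], and equality would contradict [vin_irr]. *)
Lemma vnat_inj m n : veq (vnat m) (vnat n) -> m = n.
Proof.
wlog mn : m n / m <= n => [H mn|].
  by case/orP: (leq_total m n) => ?; [|symmetry]; apply: H => //; apply: veq_sym.
move: mn; rewrite leq_eqVlt => /predU1P[//|mn eq_mn]; case: (@vin_irr (vnat n)).
by apply: vin_eql eq_mn _; apply/in_vnat; exists m => //; apply: veq_refl.
Qed.

Lemma in_vseq z s :
  vin z (vseq s) <->
  exists i k, onth s i = Some k /\ veq z (vpair (vnat i) (vnat k)).
Proof.
split=> [[i zi]|[i [k [ik zk]]]].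
  exists i, (nth 0 s i); split=> //.
  by rewrite onthE (nth_map 0).
have si : i < size s by rewrite -onthTE ik.
by exists (Ordinal si); rewrite /= (onth_nth 0 _ _ _ ik).
Qed.

Lemma in_vseq_pair s i k :
  vin (vpair (vnat i) (vnat k)) (vseq s) <-> onth s i = Some k.
Proof.
rewrite in_vseq; split=> [[j [l [jl /vpair_inj[/vnat_inj -> /vnat_inj ->]]]]//|ik].
by exists i, k; split=> //; apply: veq_refl.
Qed.

Lemma vseq_inj s t : veq (vseq s) (vseq t) -> s = t.
Proof.
move=> /veqP st; apply: eq_from_onth => i.
have H k : onth s i = Some k <-> onth t i = Some k.
  by rewrite -!in_vseq_pair.
case si: (onth s i) => [k|]; first by symmetry; apply/H.
by case ti: (onth t i) => [k|] //; rewrite -si; apply/H.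
Qed.

(* [num] and [sq] decode numbers and sequences.  Junk is sent to [0] and [[::]],
   so that quantifying over a sort amounts to quantifying over all of [M]. *)
Definition num (a : V) : nat := xget 0 [set n | veq a (vnat n)].

Definition sq (a : V) : seq nat := xget [::] [set s | veq a (vseq s)].

Lemma numE a n : veq a (vnat n) -> num a = n.
Proof.
move=> an; apply: vnat_inj; apply: veq_trans (an); apply: veq_sym.
by rewrite /num; case: xgetP => [m _ //|/(_ n)].
Qed.

Lemma sqE a s : veq a (vseq s) -> sq a = s.
Proof.
move=> an; apply: vseq_inj; apply: veq_trans (an); apply: veq_sym.
by rewrite /sq; case: xgetP => [m _ //|/(_ s)].
Qed.

Lemma num_vnat n : num (vnat n) = n. Proof. exact/numE/veq_refl. Qed.

Lemma sq_vseq s : sq (vseq s) = s. Proof. exact/sqE/veq_refl. Qed.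

Definition isnat a := exists n, veq a (vnat n).

Definition isseq a := exists s, veq a (vseq s).

Lemma num_junk a : ~ isnat a -> num a = 0.
Proof. by move=> an; rewrite /num xgetPN // => n an'; apply: an; exists n. Qed.

Lemma sq_junk a : ~ isseq a -> sq a = [::].
Proof. by move=> an; rewrite /sq xgetPN // => n an'; apply: an; exists n. Qed.

Definition zero_or_succ a :=
  (forall z, ~ vin z a) \/
  exists b, forall z, vin z a <-> vin z b \/ veq z b.

(** The right-hand side quantifies only over members of [a] and of its members, so a transitive
    model evaluates it correctly. Conversely, if [a] is the successor of [b], the condition passes
    to [b], and induction on membership applies. *)
Lemma isnatP a :
  isnat a <-> zero_or_succ a /\ forall b, vin b a -> zero_or_succ b.
Proof.
split=> [[n an]|].
  have zs b m : veq b (vnat m) -> zero_or_succ b.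
    case: m => [|m] /veqP bm; [left=> z|right; exists (vnat m) => z].
      by move/bm/in_vempty.
    by rewrite bm /= in_vsucc.
  split; first exact: zs an.
  by move=> b /(vin_eqr an)/in_vnat[m _]; apply: zs.
elim/vin_ind: a => a IH [[a0|[b ab]] zs].
  by exists 0; apply/veqP=> z; split=> [/a0|/in_vempty].
have ba : vin b a by apply/ab; right; apply: veq_refl.
have [|n bn] := IH b ba; first by split=> [|c cb]; apply: zs => //; apply/ab; left.
exists n.+1; apply/veqP=> z; rewrite ab /= in_vsucc.
split=> -[zb|zb]; [left; exact: vin_eqr zb|right; exact: veq_trans bn| |].
  by left; apply: vin_eqr zb; apply: veq_sym.
by right; apply: veq_trans zb (veq_sym bn).
Qed.

(** A finite sequence is a function from some [n] to the naturals. In this form the notion can be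
    written as a formula over [M]. *)
Lemma isseqP a :
  isseq a <-> exists n,
    [/\ forall z, vin z a -> exists i k, i < n /\ veq z (vpair (vnat i) (vnat k)),
        forall i, i < n -> exists k, vin (vpair (vnat i) (vnat k)) a &
        forall i k l, vin (vpair (vnat i) (vnat k)) a ->
          vin (vpair (vnat i) (vnat l)) a -> k = l].
Proof.
split=> [[s as_]|[n [H1 H2 H3]]].
  exists (size s); split=> [z /(vin_eqr as_)/in_vseq[i [k [ik zk]]]|i si|i k l].
  - by exists i, k; rewrite -onthTE ik.
  - exists (nth 0 s i); apply/(vin_eqr (veq_sym as_))/in_vseq_pair.
    by rewrite onthE (nth_map 0).
  - move=> /(vin_eqr as_)/in_vseq_pair ik /(vin_eqr as_)/in_vseq_pair.
    by rewrite ik => -[].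
have /choice[g gP] i : exists k, i < n -> vin (vpair (vnat i) (vnat k)) a.
  by have [/H2[k ?]|] := boolP (i < n); [exists k|exists 0].
exists (mkseq g n); apply/veqP=> z; rewrite in_vseq; split=> [za|[i [k []]]].
  have [i [k [i_n zk]]] := H1 z za; exists i, k; split=> //.
  rewrite onthE (nth_map 0) ?size_mkseq// nth_mkseq//; congr Some.
  by apply: (H3 i _ _ (gP i i_n)); apply: vin_eql zk _.
move=> ik zk; have i_n : i < n by rewrite -(size_mkseq g n) -onthTE ik.
apply: vin_eql (veq_sym zk) _; rewrite -(onth_nth 0 _ _ _ ik) nth_mkseq//; exact: gP.
Qed.
(** * Definability with parameters over [M] *)

Fixpoint frename (xi : nat -> nat) (p : formula) : formula :=
  match p with
  | FIn i j => FIn (xi i) (xi j)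
  | FEq i j => FEq (xi i) (xi j)
  | FNot q => FNot (frename xi q)
  | FAnd q r => FAnd (frename xi q) (frename xi r)
  | FAll q => FAll (frename (fun i => if i is j.+1 then (xi j).+1 else 0) q)
  end.

Lemma sat_rename M xi rho p :
  sat M rho (frename xi p) <-> sat M (fun i => rho (xi i)) p.
Proof.
elim: p xi rho => [i j|i j|p IH|p IHp q IHq|p IH] xi rho //=.
- by rewrite IH.
- by rewrite IHp IHq.
- have E a : (fun i => scons a rho (if i is j.+1 then (xi j).+1 else 0)) =
      scons a (fun i => rho (xi i)) by apply/funext => -[].
  by split=> H a Ma; have := H a Ma; rewrite IH E.
Qed.

(* [inl j] refers to the variable [j], [inr v] to the parameter [v]. *)
Definition lookup (r : nat -> nat + V) (e : nat -> V) (i : nat) : V :=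
  match r i with inl j => e j | inr v => v end.

(** * Closure of [M] under basic set operations *)

Section Model.
Context (M : V -> Prop) (HM : transitive_model_ZF M).

Lemma M_in x y : M x -> vin y x -> M y. Proof. exact: tm_transitive. Qed.

Lemma M_eq x y : veq x y -> M x -> M y. Proof. exact: tm_ext. Qed.

Lemma M_vempty : M vempty.
Proof.
have [w [_ [e [Me _ e0]] _]] := zf_infinity (tm_ZF HM).
apply: M_eq (Me); apply/veqP=> z; split=> [ze|/in_vempty//].
by case: (e0 z) => //; apply: M_in ze.
Qed.

Lemma M_vupair x y : M x -> M y -> M (vupair x y).
Proof.
move=> Mx My; have [z Mz H] := zf_pairing (tm_ZF HM) Mx My.
apply: M_eq (Mz); apply/veqP=> w; rewrite in_vupair; split=> [wz|wxy].
  by apply/(H w (M_in Mz wz)).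
have Mw : M w by case: wxy => /veq_sym wxy; [exact: M_eq wxy Mx|exact: M_eq wxy My].
exact/(H w Mw).
Qed.

Lemma M_vpair x y : M x -> M y -> M (vpair x y).
Proof. by move=> Mx My; do 2!apply: M_vupair. Qed.

Lemma M_vpair_inv x y : M (vpair x y) -> M x /\ M y.
Proof.
move=> Mxy; have Mu : M (vupair x y).
  by apply: M_in Mxy _; apply/in_vupair; right; apply: veq_refl.
by split; apply: M_in Mu _; apply/in_vupair; [left|right]; apply: veq_refl.
Qed.

Lemma M_vunion2 x y : M x -> M y ->
  exists2 u, M u & forall z, vin z u <-> vin z x \/ vin z y.
Proof.
move=> Mx My; have [u Mu H] := zf_union (tm_ZF HM) (M_vupair Mx My).
exists u => // z; split=> [zu|zxy].
  have [v [Mv /in_vupair[vx|vy] zv]] := (H z (M_in Mu zu)).1 zu.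
    by left; apply: vin_eqr zv.
  by right; apply: vin_eqr zv.
have Mz : M z by case: zxy; [apply: M_in Mx|apply: M_in My].
apply/(H z Mz); case: zxy => ?; [exists x|exists y]; split=> //; apply/in_vupair;
  [left|right]; apply: veq_refl.
Qed.

Lemma M_adjoin x y : M x -> M y ->
  exists2 u, M u & forall z, vin z u <-> vin z x \/ veq z y.
Proof.
move=> Mx My; have [u Mu H] := M_vunion2 Mx (M_vupair My My).
exists u => // z; rewrite H in_vupair.
by split=> -[|]; [left|case; right|left|right; left].
Qed.

Lemma M_vsucc x : M x -> M (vsucc x).
Proof.
move=> Mx; have [u Mu H] := M_adjoin Mx Mx.
by apply: M_eq Mu; apply/veqP=> z; rewrite H in_vsucc.
Qed.

Lemma M_vnat n : M (vnat n).
Proof. by elim: n => [|n IH]; [exact: M_vempty|exact: M_vsucc]. Qed.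

Lemma M_vseq s : M (vseq s).
Proof.
have [u Mu H] : exists2 u, M u & forall z, vin z u <->
    exists i k, i < size s /\ onth s i = Some k /\ veq z (vpair (vnat i) (vnat k)).
  (* Only the bound on [i] is generalised, [s] stays fixed; each induction step adjoins at most one
     pair. *)
  elim: {1}(size s) => [|n [u Mu H]].
    exists vempty; first exact: M_vempty.
    by move=> z; split=> [/in_vempty|[i [k []]]].
  have [w Mw K] := M_adjoin Mu (M_vpair (M_vnat n) (M_vnat (nth 0 s n))).
  have [sn|sn] := leqP (size s) n.
    exists u => // z; rewrite H; split=> -[i [k [i_n [ik zk]]]]; exists i, k; split=> //.
      exact: leqW.
    by apply: leq_trans sn; rewrite -onthTE ik.
  exists w => // z; rewrite K H; split=> [[[i [k [i_n ?]]]|zn]|[i [k]]].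
  - by exists i, k; split=> //; apply: leqW.
  - by exists n, (nth 0 s n); split=> //; split=> //; rewrite onthE (nth_map 0).
  rewrite ltnS leq_eqVlt => -[/predU1P[->|i_n] [ik zk]]; last by left; exists i, k.
  by right; rewrite (onth_nth 0 _ _ _ ik).
apply: M_eq Mu; apply/veqP=> z; rewrite H in_vseq.
split=> -[i [k]]; first by case=> _; exists i, k.
by case=> ik zk; exists i, k; rewrite -onthTE ik.
Qed.

(** * Definable predicates and their closure properties *)

Definition Menv (e : nat -> V) := forall i, M (e i).

Definition params_in (r : nat -> nat + V) := forall i v, r i = inr v -> M v.

(** Agreement is asked only for environments in [M]. A predicate quantifying over all sets therefore
    qualifies as soon as its quantifiers can be restricted to [M], for instance by transitivity. *)
Definition definable (P : (nat -> V) -> Prop) :=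
  exists r p, params_in r /\
    forall e, Menv e -> (P e <-> sat M (lookup r e) p).

Lemma Menv_lookup r e : params_in r -> Menv e -> Menv (lookup r e).
Proof.
by move=> Mr Me i; rewrite /lookup; case ri: (r i) => [j|v]; last exact: Mr ri.
Qed.

Lemma Menv_scons a e : M a -> Menv e -> Menv (scons a e).
Proof. by move=> Ma Me []. Qed.

Lemma def_lookup r P : params_in r -> definable P ->
  definable (fun e => P (lookup r e)).
Proof.
move=> Mr [s [p [Ms H]]].
exists (fun i => if s i is inl j then r j else s i), p; split.
  by move=> i v; case si: (s i) => [j|w]; [exact: Mr|rewrite -si; exact: Ms].
move=> e Me; rewrite H; last exact: Menv_lookup.
suff -> : lookup (fun i => if s i is inl j then r j else s i) e =
  lookup s (lookup r e) by [].
by apply/funext=> i; rewrite /lookup; case: (s i).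
Qed.

(** Substitution of a parameter for variable 0; this is how the shrink wrapper enters the
    formulas. *)
Lemma def_param v P : M v -> definable P -> definable (fun e => P (scons v e)).
Proof.
move=> Mv /(@def_lookup (fun i => if i is j.+1 then inl j else inr v)) H.
suff E e : scons v e = lookup (fun i => if i is j.+1 then inl j else inr v) e.
  by under eq_fun do rewrite E; apply: H => -[|i] w //= [<-].
by apply/funext=> -[].
Qed.

Lemma def_iff P Q : (forall e, Menv e -> (Q e <-> P e)) -> definable P -> definable Q.
Proof.
by move=> PQ [r [p [Mr H]]]; exists r, p; split=> // e Me; rewrite PQ// H.
Qed.

Lemma def_in i j : definable (fun e => vin (e i) (e j)).
Proof. by exists inl, (FIn i j). Qed.

Lemma def_eq i j : definable (fun e => veq (e i) (e j)).
Proof. by exists inl, (FEq i j). Qed.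

Lemma def_not P : definable P -> definable (fun e => ~ P e).
Proof. by move=> [r [p [Mr H]]]; exists r, (FNot p); split=> // e /H ->. Qed.

Lemma def_and P Q : definable P -> definable Q -> definable (fun e => P e /\ Q e).
Proof.
move=> [r [p [Mr H]]] [s [q [Ms K]]].
(* The variables of the two formulas are made disjoint: even indices serve [p], odd ones serve [q],
   so each keeps its own parameters. *)
pose t i := if odd i then s i./2 else r i./2.
have rE e : (fun i => lookup t e i.*2) = lookup r e.
  by apply/funext=> i; rewrite /lookup /t odd_double doubleK.
have sE e : (fun i => lookup t e i.*2.+1) = lookup s e.
  by apply/funext=> i; rewrite /lookup /t /= odd_double /= uphalf_double.
exists t, (FAnd (frename double p) (frename (fun i => i.*2.+1) q)); split.
  by move=> i v; rewrite /t; case: ifP => _; [exact: Ms|exact: Mr].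
by move=> e Me /=; rewrite !sat_rename rE sE H// K.
Qed.

(* As [Q] is inferred by second-order matching, this lemma and its analogues for
   the other quantifiers make definability proofs follow the syntax of the
   predicate. *)
Lemma def_allM (Q : (nat -> V) -> V -> Prop) :
  definable (fun e => Q (fun i => e i.+1) (e 0)) ->
  definable (fun e => forall a, M a -> Q e a).
Proof.
move=> [r [p [Mr H]]].
(* Every formula variable that [r] sends to variable 0 becomes the bound variable. The others move
   up by one under the binder, and what they look up moves down by one. *)
pose t i : nat + V := if r i is inl j then inl j.-1 else r i.
pose xi i := if r i is inl 0 then 0 else i.+1.
have tE a e : (fun i => scons a (lookup t e) (xi i)) = lookup r (scons a e).
  apply/funext=> i; rewrite /xi /lookup.
  by case ri: (r i) => [[|j]|v] //=; rewrite /t ri.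
exists t, (FAll (frename xi p)); split=> [i v|e Me /=].
  by rewrite /t; case ri: (r i) => [//|w]; rewrite -ri; exact: Mr.
split=> K a Ma; have := K a Ma; rewrite sat_rename tE.
  by move=> Qa; apply/H => //; exact: Menv_scons.
by move/H; apply; exact: Menv_scons.
Qed.

Lemma def_or P Q : definable P -> definable Q -> definable (fun e => P e \/ Q e).
Proof.
move=> HP HQ; apply: def_iff (def_not (def_and (def_not HP) (def_not HQ))) => e _.
by split=> [[]|/not_andP[]/contrapT] ?; [case|case|left|right].
Qed.

Lemma def_imp P Q : definable P -> definable Q -> definable (fun e => P e -> Q e).
Proof.
by move=> HP HQ; apply: def_iff (def_or (def_not HP) HQ) => e _; rewrite implyE.
Qed.

Lemma def_equiv P Q : definable P -> definable Q -> definable (fun e => P e <-> Q e).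
Proof. by move=> HP HQ; apply: def_and; apply: def_imp. Qed.

Lemma def_exM (Q : (nat -> V) -> V -> Prop) :
  definable (fun e => Q (fun i => e i.+1) (e 0)) ->
  definable (fun e => exists a, M a /\ Q e a).
Proof.
move=> HQ; apply: def_iff (def_not (@def_allM (fun e a => ~ Q e a) (def_not HQ))) => e _.
split=> [[a [Ma Qa]] /(_ a Ma Qa)//|H].
by apply: contrapT => K; apply: H => a Ma Qa; apply: K; exists a.
Qed.

End Model.

(** Follows the shape of the predicate. Set quantifiers are recognised only with the guard [M a], so
    the lemmas below first bring predicates into this guarded form. *)
Ltac def_step := cbv beta; lazymatch goal with
  | |- definable _ (fun e => _ /\ _) => apply: def_and
  | |- definable _ (fun e => _ \/ _) => apply: def_or
  | |- definable _ (fun e => _ <-> _) => apply: def_equiv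
  | |- definable _ (fun e => ~ _) => apply: def_not
  | |- definable _ (fun e => exists a : V, _ /\ _) => apply: def_exM
  | |- definable _ (fun e => forall a : V, _ -> _) => apply: def_allM
  | |- definable _ (fun e => _ -> _) => apply: def_imp
  | |- definable _ (fun e => vin (e _) (e _)) => exact: def_in
  | |- definable _ (fun e => veq (e _) (e _)) => exact: def_eq
  end.

(** * Definability of predicates on numbers and finite sequences *)

Section Sorts.
Context (M : V -> Prop) (HM : transitive_model_ZF M).

Lemma veq_onM x y : M x -> M y -> veq x y <-> forall z, M z -> (vin z x <-> vin z y).
Proof.
move=> Mx My; rewrite veqP; split=> [H z _|H z]; first exact: H.
by split=> ?; apply/H => //; [exact: M_in Mx _|exact: M_in My _].
Qed.

Lemma def_upair i j k : definable M (fun e => veq (e i) (vupair (e j) (e k))).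
Proof.
apply: (@def_iff _ (fun e => forall z, M z ->
    (vin z (e i) <-> veq z (e j) \/ veq z (e k)))); last by repeat def_step.
move=> e Me; rewrite veq_onM//; last exact: M_vupair.
by split=> H z /H; rewrite in_vupair.
Qed.

Lemma def_pair i j k : definable M (fun e => veq (e i) (vpair (e j) (e k))).
Proof.
apply: (@def_iff _ (fun e => exists a, M a /\ exists b, M b /\
    (veq a (vupair (e j) (e j)) /\ veq b (vupair (e j) (e k)) /\
    veq (e i) (vupair a b)))); last by repeat first [exact: def_upair | def_step].
move=> e Me; split=> [H|[a [_ [b [_ [aE [bE H]]]]]]].
  exists (vupair (e j) (e j)); split; first exact: M_vupair.
  exists (vupair (e j) (e k)); split; first exact: M_vupair.
  by split; [exact: veq_refl|split; [exact: veq_refl|]].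
by apply: veq_trans H _; apply: vupair_eq.
Qed.

Lemma def_pair_in i j k : definable M (fun e => vin (vpair (e i) (e j)) (e k)).
Proof.
apply: (@def_iff _ (fun e => exists a, M a /\
    (veq a (vpair (e i) (e j)) /\ vin a (e k)))); last first.
  by repeat first [exact: def_pair | def_step].
move=> e Me; split=> [H|[a [_ [/vin_eql H /H//]]]].
by exists (vpair (e i) (e j)); split; [exact: M_vpair|split; first exact: veq_refl].
Qed.

Lemma def_empty i : definable M (fun e => forall z, ~ vin z (e i)).
Proof.
apply: (@def_iff _ (fun e => forall z, M z -> ~ vin z (e i))).
  by move=> e Me; split=> H z // zi; apply: (H z) => //; apply: M_in zi.
by repeat def_step.
Qed.

Lemma def_succ i j :
  definable M (fun e => forall z, vin z (e i) <-> vin z (e j) \/ veq z (e j)).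
Proof.
apply: (@def_iff _ (fun e => forall z, M z ->
    (vin z (e i) <-> vin z (e j) \/ veq z (e j)))); last by repeat def_step.
move=> e Me; split=> H z; first by rewrite H.
have Mz : M z -> (vin z (e i) <-> vin z (e j) \/ veq z (e j)) by exact: H.
split=> [zi|zj]; first by apply: (Mz _).1 => //; exact: M_in HM _ _ (Me i) zi.
by apply: (Mz _).2 => //; case: zj => [|/veq_sym] zj;
  [exact: M_in HM _ _ (Me j) zj|exact: M_eq HM _ _ zj (Me j)].
Qed.

Lemma def_zero_or_succ i : definable M (fun e => zero_or_succ (e i)).
Proof.
apply: def_or; first exact: def_empty.
apply: (@def_iff _ (fun e => exists b, M b /\
    forall z, vin z (e i) <-> vin z b \/ veq z b)).
  move=> e Me; split=> [[b H]|[b [_ H]]]; last by exists b.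
  exists b; split=> //; apply: M_in (Me i) _ => //.
  by apply/H; right; apply: veq_refl.
by def_step; exact: def_succ.
Qed.

Lemma def_isnat i : definable M (fun e => isnat (e i)).
Proof.
apply: (@def_iff _ (fun e => zero_or_succ (e i) /\
    forall b, M b -> (vin b (e i) -> zero_or_succ b))).
  move=> e Me; rewrite isnatP; split=> -[H K]; split=> // b; first by move=> _; apply: K.
  by move=> bi; apply: K => //; apply: M_in bi.
by repeat first [exact: def_zero_or_succ | def_step].
Qed.

(** Two cases: a code of a number is equal to its own normal form, and junk, having [num] equal to
    0, is replaced by the empty set. *)
Lemma def_eq_vnat i j : definable M (fun e => veq (e i) (vnat (num (e j)))).
Proof.
apply: (@def_iff _ (fun e => (isnat (e j) /\ veq (e i) (e j)) \/
    (~ isnat (e j) /\ forall z, ~ vin z (e i)))); last first.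
  by repeat first [exact: def_isnat | exact: def_empty | def_step].
move=> e Me; have [jn|jn] := EM (isnat (e j)).
  have [n jE] := jn; rewrite (numE jE); split=> [H|].
    by left; split=> //; apply: veq_trans H (veq_sym jE).
  by case=> [[_ H]|[]//]; apply: veq_trans jE.
rewrite num_junk//; split=> [/veqP H|]; last first.
  by case=> -[//] _ H; apply/veqP=> z; split=> [/H|/in_vempty].
by right; split=> // z /H/in_vempty.
Qed.

Lemma def_alln (Q : (nat -> V) -> nat -> Prop) :
  definable M (fun e => Q (fun i => e i.+1) (num (e 0))) ->
  definable M (fun e => forall n, Q e n).
Proof.
move=> /(@def_allM _ (fun e a => Q e (num a))); apply: def_iff => e _.
by split=> H n //; rewrite -[n]num_vnat; apply: H; apply: M_vnat.
Qed.

Lemma def_exn (Q : (nat -> V) -> nat -> Prop) :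
  definable M (fun e => Q (fun i => e i.+1) (num (e 0))) ->
  definable M (fun e => exists n, Q e n).
Proof.
move=> /(@def_exM _ (fun e a => Q e (num a))); apply: def_iff => e _.
split=> [[n]|[a [_]]]; last by exists (num a).
by rewrite -{1}[n]num_vnat => H; exists (vnat n); split=> //; apply: M_vnat.
Qed.

(** Formulas have no terms, so [vnat (num (e i))] is named by a fresh variable. The name is unique
    only up to [veq], which [Q] must respect. *)
Lemma def_vnat (Q : (nat -> V) -> V -> Prop) i :
  (forall e a b, veq a b -> Q e a -> Q e b) ->
  definable M (fun e => Q (fun k => e k.+1) (e 0)) ->
  definable M (fun e => Q e (vnat (num (e i)))).
Proof.
move=> QE HQ.
apply: (@def_iff _ (fun e => exists a, M a /\ (veq a (vnat (num (e i))) /\ Q e a))).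
  move=> e Me; split=> [H|[a [_ [/QE aE /aE]]]//].
  exists (vnat (num (e i))); split; first exact: M_vnat.
  by split; first exact: veq_refl.
by def_step; apply: def_and => //; exact: def_eq_vnat.
Qed.

Lemma def_numeq i j : definable M (fun e => num (e i) = num (e j)).
Proof.
apply: (@def_iff _ (fun e => veq (vnat (num (e i))) (vnat (num (e j))))).
  by move=> e _; split=> [->|/vnat_inj]; first exact: veq_refl.
apply: (@def_vnat (fun e a => veq a (vnat (num (e j))))); last exact: def_eq_vnat.
by move=> e a b /veq_sym; apply: veq_trans.
Qed.

Lemma def_numsucc i j : definable M (fun e => num (e i) = (num (e j)).+1).
Proof.
apply: (@def_iff _ (fun e => forall z, vin z (vnat (num (e i))) <->
    vin z (vnat (num (e j))) \/ veq z (vnat (num (e j))))).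
  move=> e _; split=> [-> z|H]; first exact: in_vsucc.
  by apply: vnat_inj; apply/veqP=> z; rewrite H /= in_vsucc.
apply: (@def_vnat (fun e a => forall z, vin z a <->
    vin z (vnat (num (e j))) \/ veq z (vnat (num (e j))))).
  by move=> e a b /veqP ab H z; rewrite -ab H.
apply: (@def_vnat (fun e a => forall z, vin z (e 0) <-> vin z a \/ veq z a)).
  move=> e a b ab H z; rewrite H; split=> -[].
  - by left; apply: vin_eqr ab _.
  - by right; apply: veq_trans ab.
  - by left; apply: vin_eqr (veq_sym ab) _.
  - by right; apply: veq_trans (veq_sym ab).
exact: def_succ.
Qed.

Lemma def_numlt i j : definable M (fun e => num (e i) < num (e j)).
Proof.
apply: (@def_iff _ (fun e => vin (vnat (num (e i))) (vnat (num (e j))))).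
  move=> e _; rewrite in_vnat; split=> [H|[m mj /vnat_inj->]//].
  by exists (num (e i)) => //; apply: veq_refl.
apply: (@def_vnat (fun e a => vin a (vnat (num (e j))))).
  by move=> e a b; apply: vin_eql.
apply: (@def_vnat (fun e a => vin (e 0) a)); last exact: def_in.
by move=> e a b; apply: vin_eqr.
Qed.

Lemma def_numle i j : definable M (fun e => num (e i) <= num (e j)).
Proof.
apply: (@def_iff _ (fun e => ~ (num (e j) < num (e i)))).
  by move=> e _; rewrite leqNgt; split=> /negP.
exact/def_not/def_numlt.
Qed.

Lemma def_numcst i n : definable M (fun e => num (e i) = n).
Proof.
elim: n i => [|n IH] i.
  apply: (@def_iff _ (fun e => forall m, num (e i) <= m)).
    by move=> e _; split=> [->//|/(_ 0)]; rewrite leqn0 => /eqP.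
  by apply: def_alln; exact: def_numle.
apply: (@def_iff _ (fun e => exists m, m = n /\ num (e i) = m.+1)).
  by move=> e _; split=> [->|[m [-> ->]]//]; exists n.
by apply: def_exn; apply: def_and; [exact: IH|exact: def_numsucc].
Qed.

Lemma def_isseq i : definable M (fun e => isseq (e i)).
Proof.
apply: (@def_iff _ (fun e => exists n,
  (forall z, M z -> (vin z (e i) -> exists j k,
      j < n /\ exists a, M a /\ exists b, M b /\
        (veq a (vnat j) /\ veq b (vnat k) /\ veq z (vpair a b)))) /\
  (forall j, j < n -> exists k, exists a, M a /\ exists b, M b /\
     (veq a (vnat j) /\ veq b (vnat k) /\ vin (vpair a b) (e i))) /\
  (forall j k l, (exists a, M a /\ exists b, M b /\
     (veq a (vnat j) /\ veq b (vnat k) /\ vin (vpair a b) (e i))) ->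
     (exists a, M a /\ exists b, M b /\
     (veq a (vnat j) /\ veq b (vnat l) /\ vin (vpair a b) (e i))) -> k = l))).
  have A j k y : (vin (vpair (vnat j) (vnat k)) y) <-> exists a, M a /\ exists b, M b /\
     (veq a (vnat j) /\ veq b (vnat k) /\ vin (vpair a b) y).
    split=> [H|[a [_ [b [_ [ja [kb H]]]]]]]; last by apply: vin_eql H; apply: vpair_eq.
    exists (vnat j); split; first exact: M_vnat.
    exists (vnat k); split; first exact: M_vnat.
    by split; [exact: veq_refl|split; [exact: veq_refl|]].
  have B j k y : (veq y (vpair (vnat j) (vnat k))) <-> exists a, M a /\ exists b, M b /\
     (veq a (vnat j) /\ veq b (vnat k) /\ veq y (vpair a b)).
    split=> [H|[a [_ [b [_ [ja [kb H]]]]]]]; last first.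
      by apply: veq_trans H _; apply: vpair_eq.
    exists (vnat j); split; first exact: M_vnat.
    exists (vnat k); split; first exact: M_vnat.
    by split; [exact: veq_refl|split; [exact: veq_refl|]].
  move=> e Me; rewrite isseqP; split=> [[n [H1 H2 H3]]|[n [H1 [H2 H3]]]]; exists n; split.
  - move=> z _ /H1[j [k [jn zk]]]; exists j, k; split=> //; exact/B.
  - split=> [j /H2[k jk]|j k l /A jk /A jl]; last exact: H3 jl.
    by exists k; apply/A.
  - move=> z ze; have [j [k [jn /B zk]]] := H1 z (M_in HM (Me i) ze) ze.
    by exists j, k.
  - by move=> j /H2[k /A jk]; exists k.
  - by move=> j k l /A jk /A jl; apply: (H3 j).
by repeat first [apply: def_exn | apply: def_alln | exact: def_numlt
  | exact: def_eq_vnat | exact: def_pair | exact: def_pair_in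
  | exact: def_numeq | def_step].
Qed.

Lemma def_eq_vseq i j : definable M (fun e => veq (e i) (vseq (sq (e j)))).
Proof.
apply: (@def_iff _ (fun e => (isseq (e j) /\ veq (e i) (e j)) \/
    (~ isseq (e j) /\ forall z, ~ vin z (e i)))); last first.
  by repeat first [exact: def_isseq | exact: def_empty | def_step].
move=> e Me; have [jn|jn] := EM (isseq (e j)).
  have [n jE] := jn; rewrite (sqE jE); split=> [H|].
    by left; split=> //; apply: veq_trans H (veq_sym jE).
  by case=> [[_ H]|[]//]; apply: veq_trans jE.
rewrite sq_junk//; split=> [/veqP H|]; last first.
  by case=> -[//] _ H; apply/veqP=> z; split=> [/H//|/in_vseq[k [l []]]]; rewrite onth0n.
by right; split=> // z /H/in_vseq[k [l []]]; rewrite onth0n.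
Qed.

Lemma def_alls (Q : (nat -> V) -> seq nat -> Prop) :
  definable M (fun e => Q (fun i => e i.+1) (sq (e 0))) ->
  definable M (fun e => forall s, Q e s).
Proof.
move=> /(@def_allM _ (fun e a => Q e (sq a))); apply: def_iff => e _.
by split=> H n //; rewrite -[n]sq_vseq; apply: H; apply: M_vseq.
Qed.

Lemma def_exs (Q : (nat -> V) -> seq nat -> Prop) :
  definable M (fun e => Q (fun i => e i.+1) (sq (e 0))) ->
  definable M (fun e => exists s, Q e s).
Proof.
move=> /(@def_exM _ (fun e a => Q e (sq a))); apply: def_iff => e _.
split=> [[n]|[a [_]]]; last by exists (sq a).
by rewrite -{1}[n]sq_vseq => H; exists (vseq n); split=> //; apply: M_vseq.
Qed.

Lemma def_onth i j k :
  definable M (fun e => onth (sq (e i)) (num (e j)) = Some (num (e k))).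
Proof.
apply: (@def_iff _ (fun e => exists s, M s /\ (veq s (vseq (sq (e i))) /\
    vin (vpair (vnat (num (e j))) (vnat (num (e k)))) s))).
  move=> e _; rewrite -in_vseq_pair; split=> [H|[s [_ [sE /(vin_eqr sE)]]]//].
  exists (vseq (sq (e i))); split; first exact: M_vseq.
  by split; first exact: veq_refl.
def_step; apply: def_and; first exact: def_eq_vseq.
apply: (@def_vnat (fun e a => vin (vpair a (vnat (num (e k.+1)))) (e 0))).
  by move=> e a b ab; apply: vin_eql; apply: vpair_eq => //; apply: veq_refl.
apply: (@def_vnat (fun e a => vin (vpair (e 0) a) (e 1))); last exact: def_pair_in.
by move=> e a b ab; apply: vin_eql; apply: vpair_eq => //; apply: veq_refl.
Qed.

End Sorts.
(** * Uniformly coded families of Borel sets *)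

Ltac def_auto := repeat first
  [ assumption
  | apply: def_exn | apply: def_alln | apply: def_exs | apply: def_alls
  | exact: def_numlt | exact: def_numle | exact: def_numeq
  | exact: def_numsucc | exact: def_numcst | exact: def_onth
  | exact: def_eq_vnat | exact: def_eq_vseq | exact: def_isnat
  | exact: def_pair_in | exact: def_pair | def_step].

(** * Definable arithmetic and the coding of sequences *)

Section Arithmetic.
Context (M : V -> Prop) (HM : transitive_model_ZF M).

(** A function is treated through its graph. Nested terms and constants are unfolded below with
    auxiliary variables, as in [exists z, z = 0 /\ ...]. *)
Definition def_fun1 (f : nat -> nat) :=
  forall i j, definable M (fun e => num (e i) = f (num (e j))).

Definition def_fun2 (f : nat -> nat -> nat) :=
  forall i j k, definable M (fun e => num (e i) = f (num (e j)) (num (e k))).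

(** The witness [u] is the course of the computation, with [iter l f x] at place [l]. *)
Lemma def_iter f : def_fun1 f -> def_fun2 (fun n x => iter n f x).
Proof.
move=> Hf i j k.
apply: (@def_iff _ (fun e => exists u : seq nat,
  (exists z, z = 0 /\ onth u z = Some (num (e k))) /\
  (forall l a, l < num (e j) -> onth u l = Some a ->
     exists l' b, l' = l.+1 /\ onth u l' = Some b /\ b = f a) /\
  onth u (num (e j)) = Some (num (e i)))); last first.
  by repeat first [exact: Hf | progress def_auto].
move=> e _; set n := num (e j); set x := num (e k); set y := num (e i).
split=> [->|[u [[_ [-> u0]] [uS un]]]].
  have onthE l : l <= n -> onth (mkseq (fun l => iter l f x) n.+1) l = Some (iter l f x).
    by move=> ln; rewrite onthE (nth_map 0) ?size_mkseq// nth_mkseq.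
  exists (mkseq (fun l => iter l f x) n.+1); split; first by exists 0; rewrite onthE.
  split=> [l a ln|]; last by rewrite onthE.
  rewrite onthE ?(ltnW ln)// => -[<-].
  by exists l.+1, (f (iter l f x)); rewrite onthE.
have H l : l <= n -> onth u l = Some (iter l f x).
  elim: l => [//|l IH] ln; have [l' [b [-> [-> ->]]]] := uS _ _ ln (IH (ltnW ln)).
  by [].
by move: un; rewrite H// => -[->].
Qed.

(** The recursion step of [CodeSeq.code]: the code of [k :: s] is [code_cons k] of the code of [s],
    and the empty sequence has code 0. *)
Definition code_cons (k a : nat) := 2 ^ k * a.*2.+1.

Lemma def_double : def_fun1 double.
Proof.
move=> i j; apply: (@def_iff _ (fun e => exists z, z = 0 /\
    num (e i) = iter (num (e j)) (fun n => n.+2) z)).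
  have E n : iter n (fun n => n.+2) 0 = n.*2 by elim: n => //= n ->.
  by move=> e _; split=> [->|[_ [-> ->]]]; rewrite ?E//; exists 0; rewrite E.
have H : def_fun1 (fun n => n.+2).
  move=> k l; apply: (@def_iff _ (fun e => exists z, z = (num (e l)).+1 /\
    num (e k) = z.+1)); last by def_auto.
  by move=> e _; split=> [->|[_ [-> ->]]//]; eexists; split.
by repeat first [exact: (def_iter H) | progress def_auto].
Qed.

Lemma def_code_cons : def_fun2 code_cons.
Proof.
move=> i j k; apply: (@def_iff _ (fun e => exists a b, a = (num (e k)).*2 /\
    b = a.+1 /\ num (e i) = iter (num (e j)) double b)).
  have E n a : iter n double a = 2 ^ n * a.
    by elim: n => [|n /= ->]; rewrite ?mul1n// expnS -mulnA mul2n.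
  move=> e _; rewrite /code_cons; split=> [->|[_ [_ [-> [-> ->]]]]]; rewrite ?E//.
  by do 2!eexists; split; [|split]; rewrite ?E.
by repeat first [exact: (def_iter def_double) | exact: def_double | progress def_auto].
Qed.

(** The witness [u] lists the codes of the suffixes of the sequence [s]. Its head is the code of
    [s], neighbouring entries are related by [code_cons], and an entry past the end of [s] is 0, the
    code of [[::]]. *)
Lemma def_code i j : definable M (fun e => num (e i) = CodeSeq.code (sq (e j))).
Proof.
apply: (@def_iff _ (fun e => exists u : seq nat,
  (exists z, z = 0 /\ onth u z = Some (num (e i))) /\
  (forall l k, onth (sq (e j)) l = Some k -> exists l' a b,
    l' = l.+1 /\ onth u l = Some a /\ onth u l' = Some b /\ a = code_cons k b) /\
  (forall l a, onth u l = Some a -> ~ (exists k, onth (sq (e j)) l = Some k) ->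
    a = 0))); last first.
  by repeat first [exact: def_code_cons | progress def_auto].
move=> e _; move: (num (e i)) (sq (e j)) => {e}n s; split.
  move=> ->; have E l : l <= size s ->
      onth [seq CodeSeq.code (drop l s) | l <- iota 0 (size s).+1] l =
      Some (CodeSeq.code (drop l s)).
    by move=> ls; rewrite onth_map onthE (nth_map 0) ?size_iota// nth_iota.
  exists [seq CodeSeq.code (drop l s) | l <- iota 0 (size s).+1]; split.
    by exists 0; rewrite E// drop0.
  split=> [l k lk|l a].
    have ls : l < size s by rewrite -onthTE lk.
    exists l.+1, (CodeSeq.code (drop l s)), (CodeSeq.code (drop l.+1 s)).
    rewrite !E ?(ltnW ls)//; split=> //; split=> //; split=> //.
    by rewrite (drop_nth 0 ls) (onth_nth 0 _ _ _ lk).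
  have [ls|ls] := leqP l (size s); last first.
    by rewrite onth_default ?size_map ?size_iota.
  rewrite E// => -[<-] sl; suff -> : drop l s = [::] by [].
  apply: drop_oversize; rewrite -onthNE; apply/negP=> Hs.
  by apply: sl; case: onth Hs => // k _; exists k.
move=> [u [[_ [-> u0]] [uS uN]]].
elim: s u n u0 uS uN => [|k s IH] u n u0 uS uN.
  by apply: (uN 0) => //; case=> k; rewrite onth0n.
have [_ [a [b [-> [ua [ub aE]]]]]] := uS 0 k erefl.
move: ua; rewrite u0 => -[na]; rewrite na aE /=; congr (_ * _.*2.+1).
apply: (IH (behead u)) => [|l k' lk|l a' la sl]; first by case: (u) ub.
- have [_ [a' [b' [-> [ua' [ub' aE']]]]]] := uS l.+1 k' lk.
  by exists l.+1, a', b'; case: (u) ua' ub'.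
- by apply: (uN l.+1) => //; case: (u) la => //=; rewrite onth0n.
Qed.

Lemma def_size i j : definable M (fun e => size (sq (e i)) = num (e j)).
Proof.
apply: (@def_iff _ (fun e => forall k, k < num (e j) <->
    exists a, onth (sq (e i)) k = Some a)); last by def_auto.
move=> e _; move: (sq (e i)) (num (e j)) => s n.
have E k : (exists a, onth s k = Some a) <-> k < size s.
  rewrite -onthTE; split=> [[a ->]//|]; by case: onth => // a _; exists a.
split=> [<- k|H]; first by rewrite E.
apply/eqP; rewrite eqn_leq; apply/andP; split; rewrite leqNgt; apply/negP.
  by move=> /E/H; rewrite ltnn.
by move=> /H/E; rewrite ltnn.
Qed.

Lemma def_prefix i j : definable M (fun e => prefix (sq (e i)) (sq (e j))).
Proof.
apply: (@def_iff _ (fun e => forall k a, onth (sq (e i)) k = Some a ->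
    onth (sq (e j)) k = Some a)); last by def_auto.
move=> e _; move: (sq (e i)) (sq (e j)) => s t.
split=> [/prefixP[u ->] k a sk|H].
  by rewrite onth_cat -onthTE sk.
rewrite prefixE; apply/eqP; apply: eq_from_onth => k.
have [ks|ks] := ltnP k (size s).
  have: onth s k by rewrite onthTE.
  case sk: (onth s k) => [a|] // _; rewrite -(H _ _ sk).
  rewrite -[in RHS](cat_take_drop (size s) t) onth_cat size_take.
  have tk : k < size t by rewrite -onthTE (H _ _ sk).
  by have -> : k < (if size s < size t then size s else size t) by case: ifP.
rewrite !onth_default ?size_take//; case: ifP => // /negbT.
by rewrite -leqNgt => /leq_trans; apply.
Qed.

End Arithmetic.

(** * Borel codes definable uniformly over [M] *)

Section UniformCodes.
Context (M : V -> Prop) (HM : transitive_model_ZF M).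

Definition def_rel3s (Q : nat -> nat -> nat -> seq nat -> Prop) :=
  forall i j k l,
    definable M (fun e => Q (num (e i)) (num (e j)) (num (e k)) (sq (e l))).

Definition def_rel3 (Q : nat -> nat -> nat -> Prop) :=
  forall i j k, definable M (fun e => Q (num (e i)) (num (e j)) (num (e k))).

Definition def_fun4 (f : nat -> nat -> nat -> nat -> nat) :=
  forall i j k l m, definable M
    (fun e => num (e i) = f (num (e j)) (num (e k)) (num (e l)) (num (e m))).

(** Uniformity lies in [c], a single definable function of the three indices and the position in the
    code. The third index is spare: it is the one over which [borel_family_bigcup] takes unions. *)
Definition borel_family (A : nat -> nat -> nat -> set (nat -> nat)) :=
  exists c, def_fun4 c /\ forall p q r, borel_code (c p q r) (A p q r).

Lemma borel_family_ext A B : (forall p q r, A p q r = B p q r) ->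
  borel_family A -> borel_family B.
Proof. by move=> AB [c [Hc cA]]; exists c; split=> // p q r; rewrite -AB. Qed.

Lemma borel_family_swap A : borel_family A -> borel_family (fun p q r => A p r q).
Proof.
by move=> [c [Hc cA]]; exists (fun p q r => c p r q); split=> // i j k l m; apply: Hc.
Qed.

Lemma borel_family_setC A : borel_family A -> borel_family (fun p q r => ~` A p q r).
Proof.
move=> [c [Hc cA]]; exists (fun p q r m => if m is m'.+1 then c p q r m' else 0).
split=> [i j k l m|p q r]; last by apply: bc_compl => //; exact: cA.
apply: (@def_iff _ (fun e => (num (e m) = 0 /\ num (e i) = 0) \/
  exists m', num (e m) = m'.+1 /\
    num (e i) = c (num (e j)) (num (e k)) (num (e l)) m')); last first.
  by repeat first [exact: Hc | progress def_auto].
move=> e _; case: (num (e m)) => [|m'].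
  by split=> [->|[[]|[? []]]//]; left.
by split=> [->|[[]//|[? [[<-]]]//]]; right; exists m'.
Qed.

(** A case distinction on the third index, followed by [borel_family_bigcup], produces unions of two
    families and unions over an initial segment. *)
Lemma borel_family_if Q A B : def_rel3 Q -> borel_family A -> borel_family B ->
  borel_family (fun p q r => if `[< Q p q r >] then A p q r else B p q r).
Proof.
move=> HQ [c [Hc cA]] [d [Hd dB]].
exists (fun p q r => if `[< Q p q r >] then c p q r else d p q r).
split=> [i j k l m|p q r]; last by case: ifP.
apply: (@def_iff _ (fun e => (Q (num (e j)) (num (e k)) (num (e l)) /\
    num (e i) = c (num (e j)) (num (e k)) (num (e l)) (num (e m))) \/
  (~ Q (num (e j)) (num (e k)) (num (e l)) /\
    num (e i) = d (num (e j)) (num (e k)) (num (e l)) (num (e m))))); last first.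
  by repeat first [exact: HQ | exact: Hc | exact: Hd | progress def_auto].
move=> e _; case: asboolP => HQe; first by split=> [|[[]|[]]//]; left.
by split=> [|[[]//|[]]//]; right.
Qed.

Lemma borel_family_open Q : def_rel3s Q ->
  borel_family (fun p q r => [set x | exists2 t, Q p q r t & cylinder t x]).
Proof.
(* The leading 2 marks an open code, as [bc_open] wants a value above 1. Position [m'.+1] tells
   whether the sequence coded by [m'] satisfies [Q]. *)
move=> HQ; exists (fun p q r m => if m is m'.+1 then
  (if `[< Q p q r (CodeSeq.decode m') >] then 1 else 0) else 2); split; last first.
  move=> p q r; set c := fun m => _.
  suff -> : [set x | exists2 t, Q p q r t & cylinder t x] =
      \bigcup_(n in [set n | c n.+1 = 1]) cylinder (CodeSeq.decode n) by exact: bc_open.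
  apply/seteqP; split=> x [t]; rewrite /c /=.
    move=> Qt tx; exists (CodeSeq.code t); last by rewrite CodeSeq.codeK.
    by rewrite /= CodeSeq.codeK; case: asboolP.
  by case: asboolP => // Qt _ tx; exists (CodeSeq.decode t).
move=> i j k l m.
apply: (@def_iff _ (fun e => (num (e m) = 0 /\ num (e i) = 2) \/
  exists m' t, num (e m) = m'.+1 /\ m' = CodeSeq.code t /\
   ((Q (num (e j)) (num (e k)) (num (e l)) t /\ num (e i) = 1) \/
    (~ Q (num (e j)) (num (e k)) (num (e l)) t /\ num (e i) = 0)))); last first.
  by repeat first [exact: HQ | exact: def_code | progress def_auto].
move=> e _; case: (num (e m)) => [|m'].
  by split=> [->|[[]|[? [? []]]]//]; left.
split=> [->|[[]//|[_ [t [[<-] [-> ]]]]]]; last first.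
  by rewrite CodeSeq.codeK; case: asboolP => Qt [] [].
right; exists m', (CodeSeq.decode m'); rewrite CodeSeq.decodeK; split=> //; split=> //.
by case: asboolP; [left|right].
Qed.

Lemma borel_family_bigcup A : borel_family A ->
  borel_family (fun p q _ => \bigcup_i A p q i).
Proof.
move=> [c [Hc cA]].
(* The leading 1 marks a union. The code of the [i]-th set occupies the positions [(CodeSeq.code
   [:: i; m]).+1]; other positions get the default 0. *)
exists (fun p q _ m => if m is m'.+1 then
  (if CodeSeq.decode m' is [:: i; m''] then c p q i m'' else 0) else 1).
split=> [i j k l m|p q r]; last first.
  apply: bc_union => // i; suff -> : (fun m =>
    if CodeSeq.decode (CodeSeq.code [:: i; m]) is [:: j; l] then c p q j l else 0) =
    c p q i by [].
  by apply/funext=> m; rewrite CodeSeq.codeK.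
apply: (@def_iff _ (fun e => (num (e m) = 0 /\ num (e i) = 1) \/
  exists m', num (e m) = m'.+1 /\
   ((exists a b z d, z = 0 /\ d = code_cons b z /\ m' = code_cons a d /\
     num (e i) = c (num (e j)) (num (e k)) a b) \/
    (~ (exists a b z d, z = 0 /\ d = code_cons b z /\ m' = code_cons a d) /\
     num (e i) = 0)))); last first.
  by repeat first [exact: Hc | exact: def_code_cons | progress def_auto].
move=> e _; case: (num (e m)) => [|m'].
  by split=> [->|[[]|[? []]]//]; left.
set y := num (e i).
have -> : ((m'.+1 = 0 /\ y = 1) \/ exists m0, m'.+1 = m0.+1 /\
   ((exists a b z d, z = 0 /\ d = code_cons b z /\ m0 = code_cons a d /\
     y = c (num (e j)) (num (e k)) a b) \/
    (~ (exists a b z d, z = 0 /\ d = code_cons b z /\ m0 = code_cons a d) /\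
     y = 0))) <->
   ((exists a b, m' = CodeSeq.code [:: a; b] /\ y = c (num (e j)) (num (e k)) a b) \/
    (~ (exists a b, m' = CodeSeq.code [:: a; b]) /\ y = 0)).
  split=> [[[]//|[_ [[<-] H]]]|H]; last right; last exists m'; last split=> //.
    case: H => [[a [b [_ [_ [-> [-> H]]]]]]|[H ->]]; [left; by exists a, b|right].
    by split=> // -[a [b m'E]]; apply: H; exists a, b, 0, (code_cons b 0).
  case: H => [[a [b [-> ->]]]|[H ->]]; [left|right].
    by exists a, b, 0, (code_cons b 0).
  by split=> // -[a [b [z [d [z0 [dE m'E]]]]]]; apply: H; exists a, b; rewrite m'E dE z0.
rewrite -{2 3}(CodeSeq.decodeK m'); move: (CodeSeq.decode m') => t.
split=> [->|].
  case: t => [|a [|b [|d t]]]; [right|right|left; by exists a, b|right];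
    by split=> // -[a' [b' /(can_inj CodeSeq.codeK)]].
case=> [[a [b [/(can_inj CodeSeq.codeK)-> ->//]]]|[H ->]].
by case: t H => [|a [|b [|d t]]]// []; exists a, b.
Qed.

(** Replacement is applied to the set [w] from Infinity and the map from [n] to the pair of [n] and
    [c n]. Since [w] may have members other than numbers, the formula includes [isnat]. *)
Lemma def_vreal c : def_fun1 M c -> M (vreal c).
Proof.
move=> Hc.
have [r [p [Mr H]]] : definable M (fun e => isnat (e 0) /\ exists n, n = c (num (e 0)) /\
    exists b, M b /\ (veq b (vnat n) /\ veq (e 1) (vpair (e 0) b))).
  by repeat first [exact: Hc | progress def_auto].
(* Replacement reserves variables 0 and 1 for argument and value. The renaming [xi] brings the
   formula into this form: parameters are read from [rho], and any further variable gets the default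
   [vempty]. *)
pose rho i := if r i is inr v then v else vempty.
have Mrho i : M (rho i).
  by rewrite /rho; case ri: (r i) => [j|v]; [exact: M_vempty|exact: Mr ri].
pose xi i := match r i with inl 0 => 0 | inl 1 => 1 | _ => i.+2 end.
pose env x y := scons x (scons y (fun=> vempty)).
have Menvxy x y : M x -> M y -> Menv M (env x y).
  by move=> Mx My [|[|i]] //; exact: M_vempty.
have satE x y : M x -> M y ->
  sat M (scons x (scons y rho)) (frename xi p) <->
  isnat x /\ veq y (vpair x (vnat (c (num x)))).
  move=> Mx My; rewrite sat_rename.
  have -> : (fun i => scons x (scons y rho) (xi i)) = lookup r (env x y).
    apply/funext=> i; rewrite /xi /rho /lookup.
    by case ri: (r i) => [[|[|j]]|v] //=; rewrite ri.
  rewrite -H; last exact: Menvxy.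
  split=> [[xn [_ [-> [b [_ [bE]]]]]] /= yE|[xn yE]].
    by split=> //; apply: veq_trans yE _; apply: vpair_eq => //; exact: veq_refl.
  split=> //; exists (c (num x)); split=> //; exists (vnat (c (num x))).
  by split; [exact: M_vnat|split=> //; exact: veq_refl].
have [w [Mw [e0 [Me0 e0w e0E]] wS]] := zf_infinity (tm_ZF HM).
have wn n : vin (vnat n) w.
  elim: n => [|n IH].
    apply: vin_eql e0w; apply/veqP=> z; split=> [ze|/in_vempty//].
    by case: (e0E z) => //; exact: (M_in HM Me0).
  have [y [My yw yE]] := wS _ (M_vnat HM n) IH.
  apply: vin_eql yw; apply/veqP=> z; rewrite /= in_vsucc; split=> [zy|zn].
    exact/(yE z (M_in HM My zy)).
  have Mz : M z by apply: (M_in HM (M_vnat HM n.+1)); exact/in_vsucc.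
  exact/(yE z Mz).
have [|b Mb bE] := zf_replacement (tm_ZF HM) (p := frename xi p) (rho := rho) Mrho Mw.
  move=> x y z Mx My Mz _ /(satE _ _ Mx My)[_ yE] /(satE _ _ Mx Mz)[_ zE].
  exact: veq_trans (veq_sym zE).
apply: (M_eq HM) (Mb); apply/veqP=> y; split=> [yb|[n yE]].
  have My := M_in HM Mb yb.
  have [x [Mx _ /(satE _ _ Mx My)[[n xn] yE]]] := (bE y My).1 yb.
  exists n; rewrite -(numE xn); apply: veq_trans yE _.
  by apply: vpair_eq; [rewrite (numE xn)|exact: veq_refl].
have My : M y.
  apply: (M_eq HM (veq_sym yE)); apply: M_vpair => //; exact: M_vnat.
apply/(bE y My); exists (vnat n); split=> //; first exact: M_vnat.
apply/satE => //; first exact: M_vnat.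
by split; [exists n; exact: veq_refl|rewrite num_vnat].
Qed.

(** The codes at spare index 0 are merged into one real, in the layout of [borel_fun_code]. Its
    graph is still definable, so [def_vreal] applies. *)
Lemma borel_family_in_M A : borel_family A ->
  exists2 c, forall n k,
    borel_code (fun m => c (CodeSeq.code [:: n; k; m])) (A n k 0) & M (vreal c).
Proof.
move=> [d [Hd dA]].
exists (fun N => if CodeSeq.decode N is [:: n; k; m] then d n k 0 m else 0).
  move=> n k; suff -> : (fun m => if CodeSeq.decode (CodeSeq.code [:: n; k; m])
    is [:: n'; k'; m'] then d n' k' 0 m' else 0) = d n k 0 by [].
  by apply/funext=> m; rewrite CodeSeq.codeK.
apply: def_vreal => i j.
apply: (@def_iff _ (fun e =>
    (exists n k m z a b, z = 0 /\ a = code_cons m z /\ b = code_cons k a /\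
      num (e j) = code_cons n b /\ num (e i) = d n k z m) \/
    (~ (exists n k m z a b, z = 0 /\ a = code_cons m z /\ b = code_cons k a /\
      num (e j) = code_cons n b) /\ num (e i) = 0))); last first.
  by repeat first [exact: Hd | exact: def_code_cons | progress def_auto].
move=> e _; rewrite -{2 3}(CodeSeq.decodeK (num (e j))).
move: (CodeSeq.decode (num (e j))) (num (e i)) => t y.
have inj n k m : CodeSeq.code t = code_cons n (code_cons k (code_cons m 0)) ->
    t = [:: n; k; m] by move=> H; apply: (can_inj CodeSeq.codeK).
split=> [->|].
  case: t inj => [|n [|k [|m [|l t]]]] inj;
    try by right; split=> // -[? [? [? [_ [_ [_ [-> [-> [-> /inj]]]]]]]]].
  by left; exists n, k, m, 0, (code_cons m 0), (code_cons k (code_cons m 0)).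
case=> [[n [k [m [_ [_ [_ [-> [-> [-> [/inj-> ->]]]]]]]]]]//|[H ->]].
case: t H {inj} => [|n [|k [|m [|l t]]]]// []; exists n, k, m, 0.
by exists (code_cons m 0), (code_cons k (code_cons m 0)).
Qed.

End UniformCodes.
(** * The shrink wrapper inside [M] *)

Lemma in_vtree T t : vin (vseq t) (vtree T) <-> T t.
Proof.
split=> [[[u Tu] /= /vseq_inj ->//]|Tt].
by exists (exist _ t Tt); exact: veq_refl.
Qed.

(** The tuple of bits is passed as a sequence [r] of numbers. This removes the dependent type and
    leaves only arguments of the sorts that the definability lemmas handle. *)
Definition wrapper_rel (eta : nat -> pairs) (F : wrapper_family)
    (nt n : nat) (r t : seq nat) : Prop :=
  n \in val (eta nt) /\
  exists s : nt.-tuple bool, r = map nat_of_bool s /\ F nt n s t.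

Section WrapperInM.
Context (M : V -> Prop) (HM : transitive_model_ZF M).
Context (eta : nat -> pairs) (F : wrapper_family) (I : nat -> set (nat -> nat)).
Arguments F : clear implicits.
Context (W_M : M (vwrapper eta F I)).

(** The first component of [vwrapper eta F I], which serves as parameter in the formulas below. *)
Let W := vfun (fun p : {p : nat * nat | p.2 \in val (eta p.1)} =>
             vpair (vnat (sval p).1) (vnat (sval p).2))
          (fun p => vfun (fun s : (sval p).1.-tuple bool => vbits s)
                         (fun s => vtree (F (sval p).1 (sval p).2 s))).

Let Wfun nt n := vfun (fun s : nt.-tuple bool => vbits s) (fun s => vtree (F nt n s)).

Let MW : M W. Proof. by have [] := M_vpair_inv HM W_M. Qed.

Let in_W nt n h : vin (vpair (vpair (vnat nt) (vnat n)) h) W <->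
  n \in val (eta nt) /\ veq h (Wfun nt n).
Proof.
split=> [[[[nt' n'] /= H]]|[H hE]].
  by case/vpair_inj=> /vpair_inj[/vnat_inj-> /vnat_inj->].
exists (exist (fun p : nat * nat => p.2 \in val (eta p.1)) (nt, n) H).
by apply: vpair_eq => //; exact: veq_refl.
Qed.

Let in_Wfun nt n r tau : vin (vpair (vseq r) tau) (Wfun nt n) <->
  exists s : nt.-tuple bool, r = map nat_of_bool s /\ veq tau (vtree (F nt n s)).
Proof.
split=> [[s /vpair_inj[/vseq_inj rE tauE]]|[s [-> tauE]]]; exists s => //.
by apply: vpair_eq => //; exact: veq_refl.
Qed.

Let M_Wfun nt n : n \in val (eta nt) -> M (Wfun nt n).
Proof.
move=> H; suff : vin (vpair (vpair (vnat nt) (vnat n)) (Wfun nt n)) W.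
  by move=> /(M_in HM MW)/(M_vpair_inv HM)[].
by apply/in_W; split=> //; exact: veq_refl.
Qed.

Let inW (e : nat -> V) i j k l := exists a, M a /\ (veq a (vnat (num (e i))) /\
  exists b, M b /\ (veq b (vnat (num (e j))) /\ exists p, M p /\
  (veq p (vpair a b) /\ vin (vpair p (e k)) (e l)))).

Let inWP e i j k l : inW e i j k l <->
  vin (vpair (vpair (vnat (num (e i))) (vnat (num (e j)))) (e k)) (e l).
Proof.
split=> [[a [_ [aE [b [_ [bE [p [_ [pE]]]]]]]]]|H].
  apply: vin_eql; apply: vpair_eq; last exact: veq_refl.
  by apply: veq_trans pE _; apply: vpair_eq.
have Ma := M_vnat HM (num (e i)); have Mb := M_vnat HM (num (e j)).
exists (vnat (num (e i))); split=> //; split; first exact: veq_refl.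
exists (vnat (num (e j))); split=> //; split; first exact: veq_refl.
eexists; split; last by split; [exact: veq_refl|exact: H].
exact: M_vpair.
Qed.

(** The map [eta] is recovered from the domain of the wrapper family: [n] belongs to [eta nt]
    exactly if [W] has a value at the pair of [nt] and [n]. *)
Lemma def_mem_pairs i j :
  definable M (fun e => num (e j) \in val (eta (num (e i)))).
Proof.
apply: (@def_iff _ (fun e => exists h, M h /\
    inW (scons h (scons W e)) i.+2 j.+2 0 1)); last first.
  apply: (@def_param _ W (fun e => exists h, M h /\
    inW (scons h e) i.+2 j.+2 0 1)) => //.
  by def_step; rewrite /inW /=; def_auto.
move=> e _; split=> [H|[h [_ /inWP/in_W[]//]]].
exists (Wfun (num (e i)) (num (e j))); split; first exact: M_Wfun.
by apply/inWP/in_W; split=> //; exact: veq_refl.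
Qed.

Lemma def_wrapper_rel i j k l : definable M (fun e =>
  wrapper_rel eta F (num (e i)) (num (e j)) (sq (e k)) (sq (e l))).
Proof.
apply: (@def_iff _ (fun e => exists h, M h /\
    (inW (scons h (scons W e)) i.+2 j.+2 0 1 /\
    exists r, M r /\ (veq r (vseq (sq (e k))) /\
    exists tau, M tau /\ (vin (vpair r tau) h /\
    exists t, M t /\ (veq t (vseq (sq (e l))) /\ vin t tau)))))); last first.
  apply: (@def_param _ W (fun e => exists h, M h /\
    (inW (scons h e) i.+2 j.+2 0 1 /\
    exists r, M r /\ (veq r (vseq (sq (e k.+1))) /\
    exists tau, M tau /\ (vin (vpair r tau) h /\
    exists t, M t /\ (veq t (vseq (sq (e l.+1))) /\ vin t tau)))))) => //.
  by def_step; rewrite /inW /=; def_auto.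
move=> e _; split=> [[H [s [rE Ft]]]|].
  exists (Wfun (num (e i)) (num (e j))); split; first exact: M_Wfun.
  split; first by apply/inWP/in_W; split=> //; exact: veq_refl.
  exists (vseq (sq (e k))); split; first exact: M_vseq.
  split; first exact: veq_refl.
  have inF : vin (vpair (vseq (sq (e k))) (vtree (F (num (e i)) (num (e j)) s)))
      (Wfun (num (e i)) (num (e j))).
    by apply/in_Wfun; exists s; split=> //; exact: veq_refl.
  exists (vtree (F (num (e i)) (num (e j)) s)); split.
    by have [] := M_vpair_inv HM (M_in HM (M_Wfun H) inF).
  split=> //; exists (vseq (sq (e l))); split; first exact: M_vseq.
  by split; [exact: veq_refl|apply/in_vtree].
move=> [h [_ [/inWP/in_W /=[H hE] [r [_ [rE [tau [_ [rtau [t [_ [tE ttau]]]]]]]]]]]].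
split=> //.
have /in_Wfun[s [sE tauE]] :
    vin (vpair (vseq (sq (e k))) tau) (Wfun (num (e i)) (num (e j))).
  apply: (vin_eqr hE); apply: vin_eql rtau.
  by apply: vpair_eq => //; exact: veq_refl.
exists s; split=> //; apply/in_vtree.
exact: vin_eqr tauE (vin_eql tE ttau).
Qed.

End WrapperInM.
(** * Borel sets of reals *)

Lemma mkseq_eqP (x y : nat -> nat) n :
  mkseq x n = mkseq y n <-> forall i, i < n -> x i = y i.
Proof.
split=> [E i i_n|E].
  by move: (congr1 (nth 0 ^~ i) E); rewrite /= !nth_mkseq.
by apply: (eq_from_nth (x0 := 0)) => [|i]; rewrite !size_mkseq// => i_n;
  rewrite !nth_mkseq// E.
Qed.

Lemma cylinder_mkseq x n y : cylinder (mkseq x n) y <-> forall i, i < n -> y i = x i.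
Proof. by rewrite -mkseq_eqP /cylinder /= size_mkseq. Qed.

Lemma cylinder_nth s y : cylinder s y <-> forall i, i < size s -> y i = nth 0 s i.
Proof. by rewrite -{1}(mkseq_nth 0 s) cylinder_mkseq. Qed.

Lemma borel_setC A : borel_set A -> borel_set (~` A).
Proof. by move=> /sigma_algebraCD; rewrite setTD. Qed.

Lemma borel_bigcup (A : nat -> set (nat -> nat)) :
  (forall i, borel_set (A i)) -> borel_set (\bigcup_i A i).
Proof. exact: sigma_algebra_bigcup. Qed.

Lemma borel_set0 : borel_set set0. Proof. exact: sigma_algebra0. Qed.

Lemma borel_bigcap (A : nat -> set (nat -> nat)) :
  (forall i, borel_set (A i)) -> borel_set (\bigcap_i A i).
Proof.
move=> mA; rewrite -[X in borel_set X]setCK setC_bigcap.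
exact: (borel_setC (borel_bigcup (fun i => borel_setC (mA i)))).
Qed.

Lemma borel_eval i k : borel_set [set x | x i = k].
Proof.
apply: (@sub_sigma_algebra _ setT
  [set U | @open (prod_topology (fun _ : nat => nat)) U]) => /=.
have /continuousP : continuous
    (fun x : prod_topology (fun _ : nat => nat) => x i) by exact: proj_continuous.
by move=> /(_ [set k]); apply; exact: discrete_open.
Qed.

Lemma borel_cylinder_preimage (g : (nat -> nat) -> nat -> nat) s :
  (forall n k, borel_set [set x | g x n = k]) -> borel_set (g @^-1` cylinder s).
Proof.
move=> mg; have -> : g @^-1` cylinder s =
    \bigcap_i [set x | i < size s -> g x i = nth 0 s i].
  apply/seteqP; split=> x /=; rewrite cylinder_nth; first by move=> H i _; apply: H.
  by move=> H i; apply: H.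
apply: borel_bigcap => i; have [_|_] := boolP (i < size s).
  suff -> : [set x | true -> g x i = nth 0 s i] = [set x | g x i = nth 0 s i] by [].
  by apply/seteqP; split=> x //=; apply.
suff -> : [set x | false -> g x i = nth 0 s i] = ~` set0.
  exact: borel_setC borel_set0.
by apply/seteqP; split=> x //= _ [].
Qed.

(** The sets containing a cylinder around [x] form a filter. It converges to [x] in every
    coordinate, hence in the product topology, and so it contains [U]. *)
Lemma open_cylinder (U : set (nat -> nat)) x :
  @open (prod_topology (fun _ : nat => nat)) U -> U x ->
  exists n, cylinder (mkseq x n) `<=` U.
Proof.
move=> oU Ux; pose G : set_system (nat -> nat) :=
  [set A | exists n, cylinder (mkseq x n) `<=` A].
have FG : Filter G.
  split; first by exists 0.
    move=> A B [m mA] [n nB]; exists (maxn m n) => y /cylinder_mkseq H; split.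
      by apply/mA/cylinder_mkseq => i im; apply: H; rewrite leq_max im.
    by apply/nB/cylinder_mkseq => i i_n; apply: H; rewrite leq_max i_n orbT.
  by move=> A B AB [n nA]; exists n => y /nA/AB.
suff : G --> (x : prod_topology (fun _ : nat => nat)).
  by apply; apply: open_nbhs_nbhs.
apply/cvg_sup => i A /=.
rewrite (@nbhsE (initial_topology (fun y : nat -> nat => y i))).
move=> -[B [[C oC <-] Cx] BA].
exists i.+1 => y /cylinder_mkseq H; apply: BA.
by rewrite /= (H i).
Qed.

(** An open set is the union of the cylinders it contains, and [CodeSeq.decode] enumerates them.
    Preimages of cylinders are Borel by hypothesis on the coordinates of [g]. *)
Lemma borel_fun_eval (g : (nat -> nat) -> nat -> nat) :
  (forall n k, borel_set [set x | g x n = k]) -> borel_fun g.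
Proof.
move=> mg; rewrite /borel_fun /borel_set; apply: smallest_sub.
  split=> [|A mA|A mA] /=; first by rewrite preimage_set0; exact: borel_set0.
    by rewrite setTD preimage_setC; exact: borel_setC.
  by rewrite preimage_bigcup; exact: borel_bigcup.
move=> U /= oU.
have -> : g @^-1` U = \bigcup_n (if `[< cylinder (CodeSeq.decode n) `<=` U >]
    then g @^-1` cylinder (CodeSeq.decode n) else set0).
  apply/seteqP; split=> x; last by move=> [n _]; case: asboolP => // H /H.
  move=> /(open_cylinder oU)[n nU]; exists (CodeSeq.code (mkseq (g x) n)) => //.
  by rewrite CodeSeq.codeK; case: asboolP => // _; apply/cylinder_mkseq.
apply: borel_bigcup => n; case: ifP => _; last exact: borel_set0.
exact: borel_cylinder_preimage.
Qed.

Lemma borel_code_borel c A : borel_code c A -> borel_set A.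
Proof.
elim=> {c A} [c _|c A _ _|c A _ _]; [|exact: borel_setC|exact: borel_bigcup].
have -> : \bigcup_(n in [set n | c n.+1 = 1]) cylinder (CodeSeq.decode n) =
    \bigcup_n (if c n.+1 == 1 then id @^-1` cylinder (CodeSeq.decode n) else set0).
  apply/seteqP; split=> x [n]; first by move=> /= cn nx; exists n; rewrite //= cn eqxx.
  by move=> _; case: eqP => // cn nx; exists n.
apply: borel_bigcup => n; case: ifP => _; last exact: borel_set0.
by apply: (@borel_cylinder_preimage id) => i k; exact: borel_eval.
Qed.

(** * The dominating function *)

(** A real that is not a branch of [T s] leaves [T s] at some level and never returns, trees being
    closed under prefixes. As [S] is finite, the maximum of these levels works for all [s]. *)
Lemma branches_exit (S : finType) (T : S -> set (seq nat)) (x : nat -> nat) :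
  (forall s, is_tree (T s)) ->
  exists L, forall k s, L <= k -> T s (mkseq x k) -> branches (T s) x.
Proof.
move=> treeT.
have /choice[lev levP] s : exists l, T s (mkseq x l) -> branches (T s) x.
  have [[l Tl]|H] := EM (exists l, ~ T s (mkseq x l)); first by exists l.
  by exists 0 => _ n; apply: contrapT => K; apply: H; exists n.
exists (\max_s lev s) => k s Lk Tk; apply: levP; apply: treeT Tk.
have -> : k = lev s + (k - lev s) by rewrite subnKC// (leq_trans _ Lk)// leq_bigmax.
by rewrite /mkseq iotaD map_cat prefix_prefix.
Qed.

(** * Bounding sets and domination of [fX X] *)

Section Domination.
Context (eta : nat -> pairs) (F : wrapper_family) (X : nat -> nat -> nat).
Arguments F : clear implicits.
Context (treeF : forall nt n, n \in val (eta nt) ->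
  forall s : nt.-tuple bool, is_tree (F nt n s)).
Local Notation T := (wrapper_rel eta F).

Definition exit_at (n k : nat) (t : seq nat) : Prop :=
  size t = k /\ exists nt, n \in val (eta nt) /\ forall r, ~ T nt n r t.

(** The failure of alternative (2), witnessed by an initial segment [t] of [x] and hence open in
    [x]. In the last disjunct [u] is x|k, and [t] shows that [x] later leaves the tree given by
    [r]. *)
Definition unsettled_at (n k : nat) (t : seq nat) : Prop :=
  (exists j, exit_at n j t) \/ k < n \/
  exists nt m r u, m < n /\ n \in val (eta nt) /\ m \in val (eta nt) /\
    T nt n r u /\ ~ T nt n r t /\ size u = k /\ prefix u t.

(** Alternative (1) contributes an open set, alternative (2) the complement of an open set. *)
Definition bound_set (n k : nat) : set (nat -> nat) :=
  [set x | exists2 t, exit_at n k t & cylinder t x] `|`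
  ~` [set x | exists2 t, unsettled_at n k t & cylinder t x].

Lemma wrapper_relP nt n (s : nt.-tuple bool) t : n \in val (eta nt) ->
  F nt n s t -> T nt n (map nat_of_bool s) t.
Proof. by move=> H Ft; split=> //; exists s. Qed.

Lemma wrapper_relE nt n r t u : T nt n r t ->
  exists s : nt.-tuple bool, F nt n s t /\ (F nt n s u -> T nt n r u).
Proof.
move=> [H [s [-> Ft]]]; exists s; split=> // Fu; exact: wrapper_relP.
Qed.

Lemma cylinder_prefix u t x : prefix u t -> cylinder t x -> u = mkseq x (size u).
Proof.
move=> /prefixP[v ->]; rewrite cylinder_nth => H.
apply: (eq_from_nth (x0 := 0)) => [|i ui]; rewrite ?size_mkseq// nth_mkseq//.
by rewrite H ?nth_cat ?ui// size_cat ltn_addr.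
Qed.

Lemma cylinderE t x : cylinder t x -> t = mkseq x (size t).
Proof. by move/esym. Qed.

(** If [x] meets (1) at no level, it has to settle with respect to the trees for the finitely many
    pairs [{m, n}] with [m < n], and [branches_exit] supplies a level for each pair. *)
Lemma bound_set_total (eta_inj : injective eta) n x : exists k, bound_set n k x.
Proof.
have [[k xk]|nex] := EM (exists k, [set x | exists2 t, exit_at n k t & cylinder t x] x).
  by exists k; left.
have /choice[L LP] nt : exists L, n \in val (eta nt) -> forall k (s : nt.-tuple bool),
    L <= k -> F nt n s (mkseq x k) -> branches (F nt n s) x.
  have [H|] := boolP (n \in val (eta nt)); last by exists 0.
  by have [L LP] := branches_exit x (treeF H); exists L.
(* By injectivity of [eta] at most one index carries the pair [{m, n}]; [b m] is this index if it
   exists, and 0 otherwise. *)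
have /choice[b bP] m : exists b, forall nt, m != n ->
    n \in val (eta nt) -> m \in val (eta nt) -> nt = b.
  have [[b [mn nb mb]]|H] :=
      EM (exists b, [/\ m != n, n \in val (eta b) & m \in val (eta b)]).
    have pairE nt : n \in val (eta nt) -> m \in val (eta nt) ->
        val (eta nt) = [fset m; n]%fset.
      move=> nnt mnt; apply/esym/eqP; rewrite eqEfcard cardfs2 mn (eqP (valP (eta nt))) andbT.
      by apply/fsubsetP => j; rewrite !inE => /orP[]/eqP->.
    exists b => nt _ nnt mnt; apply/eta_inj/val_inj.
    by rewrite /= (pairE _ nnt mnt) (pairE _ nb mb).
  by exists 0 => nt mn nnt mnt; case: H; exists nt.
(* The summand [n] secures [n <= k]. Beyond the maximum, lying in a tree at one of these indices
   implies being a branch of it. *)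
exists (n + \max_(m < n) L (b m)); right=> -[t unt tx].
case: unt => [[j xj]|[]]; first by apply: nex; exists j, t.
  by rewrite ltnNge leq_addr.
move=> [nt [m [r [u [mn [nnt [mnt [Tu [nTt [uk ut]]]]]]]]]].
have [s [Fu Ft]] := wrapper_relE t Tu; apply: nTt; apply: Ft.
rewrite (cylinderE tx); apply: (LP nt nnt (size u)).
  rewrite uk; apply: leq_trans (leq_addl _ _).
  rewrite (bP m nt _ nnt mnt) ?(ltn_eqF mn)//.
  exact: (leq_bigmax (F := fun m : 'I_n => L (b m)) (Ordinal mn)).
by rewrite -(cylinder_prefix ut tx).
Qed.

Context (coverX : forall nt n, n \in val (eta nt) ->
  exists s : nt.-tuple bool, branches (F nt n s) (X n)).
Context (eta_surj : forall m n, m != n ->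
  exists nt, val (eta nt) = [fset m; n]%fset).

(** Amounts to [x <> X n] and [k <= fX X x n], so equality of [k] and [fX X x n] also counts as
    bad. *)
Let bad n k x := x <> X n /\ mkseq x k = mkseq (X n) k.

Lemma fX_bound n k x : ~ bad n k x -> fX X x n <= k.
Proof.
move=> nbad; rewrite /fX; case: pselect => // h; case: ex_minnP => l xl lmin.
rewrite leqNgt; apply/negP => kl; apply: nbad; split.
  by move=> xX; move: xl; rewrite xX eqxx.
apply/mkseq_eqP => i ik; apply/eqP; apply: contraT => /lmin.
by rewrite leqNgt (ltn_trans ik kl).
Qed.

(** At each index some tree has the branch [X n] and thus contains x|k, which rules out (1). The
    conclusions then negate the disjuncts of [unsettled_at]: [k < n], an exit at the level from
    [branches_exit], and a later departure from a tree containing x|k. *)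
Lemma bad_branch n k x : bound_set n k x -> bad n k x ->
  [/\ n <= k, forall nt, n \in val (eta nt) ->
        exists s : nt.-tuple bool, branches (F nt n s) x &
      forall nt m (s : nt.-tuple bool), m < n -> n \in val (eta nt) ->
        m \in val (eta nt) -> F nt n s (mkseq x k) -> branches (F nt n s) x].
Proof.
have cyl j : cylinder (mkseq x j) x by apply/cylinder_mkseq.
move=> [[t [tk [nt [nnt nT]]] tx] [xX xXk]|settled [xX xXk]].
  have [s Xs] := coverX nnt; case: (nT (map nat_of_bool s)).
  by apply: wrapper_relP => //; rewrite (cylinderE tx) tk xXk; exact: Xs.
split.
- rewrite leqNgt; apply/negP=> kn; apply: settled.
  by exists (mkseq x k) => //; right; left.
- move=> nt nnt; have [L LP] := branches_exit x (treeF nnt).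
  apply: contrapT => H; apply: settled; exists (mkseq x L) => //; left; exists L.
  split; first by rewrite size_mkseq.
  exists nt; split=> // r [_ [s [_ /(LP L s (leqnn L)) xs]]].
  by apply: H; exists s.
move=> nt m s mn nnt mnt Fk j; apply: contrapT => nFj.
(* The length [k + j] makes this segment extend both x|k and the node x|j missing from the tree. *)
apply: settled; exists (mkseq x (k + j)) => //; right; right.
exists nt, m, (map nat_of_bool s), (mkseq x k).
have pre a b : prefix (mkseq x a) (mkseq x (a + b)).
  by rewrite /mkseq iotaD map_cat prefix_prefix.
do 3!split=> //; split; first exact: wrapper_relP.
split; last by rewrite size_mkseq; split.
(* Turning bits into numbers is injective, so [s'] is [s]; closure under prefixes then puts x|j into
   the tree. *)
move=> [_ [s' [/(inj_map (can_inj oddb)) /val_inj <-]]] Fkj.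
by apply: nFj; apply: (treeF nnt _ Fkj); rewrite addnC.
Qed.

Context (disjX : forall nt n1 n2, val (eta nt) = [fset n1; n2]%fset ->
    forall s1 s2 : nt.-tuple bool,
    let C1 := branches (F nt n1 s1) in
    let C2 := branches (F nt n2 s2) in
    [\/ C1 = C2 /\ (C1 (X n1) \/ C2 (X n2) -> X n1 = X n2),
        exists x, C1 = [set x] /\ C2 = [set x] |
        C1 `&` C2 = set0]).

Lemma bad_eq m n j k x : m < n -> bound_set m j x -> bad m j x ->
  bound_set n k x -> bad n k x -> X m = X n.
Proof.
move=> mn mj badm nk badn.
have [nt ntE] := eta_surj (negbT (ltn_eqF mn)).
have mnt : m \in val (eta nt) by rewrite ntE !inE eqxx.
have nnt : n \in val (eta nt) by rewrite ntE !inE eqxx orbT.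
have [_ /(_ _ mnt)[s1 xs1] _] := bad_branch mj badm.
have [s2 Xs2] := coverX nnt.
have [xX xXk] := badn.
have [_ _ /(_ _ _ s2 mn nnt mnt)] := bad_branch nk badn.
(* The tree with branch [X n] contains x|k, which equals X_n|k; hence [x] is a branch of it too. *)
rewrite xXk => /(_ (Xs2 k)) xs2.
have /= [[_ H]|[y [_ yE]]|disj] := disjX ntE s1 s2.
- by apply: H; right.
- by move: xs2 Xs2; rewrite yE /= => xy Xy; case: xX; rewrite xy Xy.
- by have : (set0 : set (nat -> nat)) x by rewrite -disj; split.
Qed.

Lemma bound_dominates (g : (nat -> nat) -> nat -> nat) :
  (forall x n, bound_set n (g x n) x) -> forall x, eventually_le (fX X x) (g x).
Proof.
move=> gP x; have [[m badm]|nbad] := EM (exists m, bad m (g x m) x); last first.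
  apply: nearW => n; apply: fX_bound => badn; apply: nbad; by exists n.
(* Past this threshold a bad [n] has [X n] equal to [X m], so [fX X x n] is the fixed value
   [fX X x m], which is at most [n] and hence at most [g x n]. *)
exists (maxn m.+1 (fX X x m)) => // n /=; rewrite geq_max => /andP[mn fn].
have [badn|] := EM (bad n (g x n) x); last exact: fX_bound.
have E : fX X x n = fX X x m.
  by rewrite /fX (bad_eq mn (gP x m) badm (gP x n) badn).
have [nk _ _] := bad_branch (gP x n) badn.
by rewrite E (leq_trans fn).
Qed.

End Domination.

(** * Borel codes for the bounding sets *)

Section BoundCode.
Context (M : V -> Prop) (HM : transitive_model_ZF M).
Context (eta : nat -> pairs) (F : wrapper_family) (I : nat -> set (nat -> nat)).
Context (W_M : M (vwrapper eta F I)).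

Lemma def_exit_at i j k :
  definable M (fun e => exit_at eta F (num (e i)) (num (e j)) (sq (e k))).
Proof.
rewrite /exit_at.
by repeat first [exact: (def_wrapper_rel HM W_M) | exact: (def_mem_pairs HM W_M)
  | exact: def_size | progress def_auto].
Qed.

Lemma def_unsettled_at i j k :
  definable M (fun e => unsettled_at eta F (num (e i)) (num (e j)) (sq (e k))).
Proof.
rewrite /unsettled_at.
by repeat first [exact: (def_wrapper_rel HM W_M) | exact: (def_mem_pairs HM W_M)
  | exact: def_size | exact: def_prefix | exact: def_exit_at | progress def_auto].
Qed.

Lemma borel_family_bound : borel_family M (fun n k _ => bound_set eta F n k).
Proof.
pose O1 n k (_ : nat) := [set x | exists2 t, exit_at eta F n k t & cylinder t x].
pose O2 n k (_ : nat) := [set x | exists2 t, unsettled_at eta F n k t & cylinder t x].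
have B1 : borel_family M O1.
  apply: (@borel_family_open _ HM (fun n k _ => exit_at eta F n k)) => i j k l.
  exact: def_exit_at.
have B2 : borel_family M O2.
  apply: (@borel_family_open _ HM (fun n k _ => unsettled_at eta F n k)) => i j k l.
  exact: def_unsettled_at.
have H0 : def_rel3 M (fun _ _ i => i = 0) by move=> i j k; exact: def_numcst.
(* The union of two sets as a countable one: index 0 selects [O1], every other index the complement
   of [O2]. *)
have := borel_family_bigcup HM
  (borel_family_if H0 B1 (borel_family_setC HM B2)).
apply: borel_family_ext => n k _.
apply/seteqP; split=> x.
  by move=> [i _]; case: asboolP => _; [left|right].
by move=> [H|H]; [exists 0|exists 1] => //; case: asboolP.
Qed.

Lemma borel_family_first A : borel_family M (fun n k _ => A n k) ->
  borel_family M (fun n k _ => A n k `&` \bigcap_(i < k) ~` A n i).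
Proof.
move=> HA; have HA' := borel_family_setC HM HA.
have Hlt : def_rel3 M (fun _ k i => i < k) by move=> i j k; exact: def_numlt.
(* The complement of the target is the union over [i] of [A n i] for [i < k] and of the complement
   of [A n k] for the remaining [i]. *)
have := borel_family_setC HM (borel_family_bigcup HM
  (borel_family_if Hlt (borel_family_swap HA) HA')).
apply: borel_family_ext => n k _; apply/seteqP; split=> x.
  move=> H; split.
    apply: contrapT => nA; apply: H; exists k => //.
    by case: asboolP; rewrite ?ltnn.
  by move=> i /= ik nA; apply: H; exists i => //; case: asboolP.
by move=> [Ak Ai] [i _]; case: asboolP => [ik|_]; [exact: Ai|apply].
Qed.

End BoundCode.

Theorem theorem2p4
  (M : V -> Prop)
  (f : nat -> nat -> nat) (eta : nat -> pairs) (Phi : seq bool * nat -> nat)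
  (X : nat -> nat -> nat)
  (F : wrapper_family) (I : nat -> set (nat -> nat))
  (M_ZF : transitive_model_ZF M)
  (f_pos : forall i l, f i l <> 0)
  (f_comp : computable2 f)
  (f_fto : finite_to_one (fun p : nat * nat => f p.1 p.2))
  (eta_bij : bijective eta)
  (eta_comp : computable_pairs eta)
  (Phi_fto : finite_to_one Phi)
  (Phi_M : M (vPhi Phi))
  (W_sw : shrink_wrapper f eta Phi X F I)
  (W_M : M (vwrapper eta F I)) :
  exists g : (nat -> nat) -> nat -> nat,
    [/\ borel_fun g,
        has_borel_code_in M g &
        forall x : nat -> nat, eventually_le (fX X x) (g x)].
Proof.
have treeF nt n : n \in val (eta nt) -> forall s : nt.-tuple bool, is_tree (F nt n s).
  by move=> H s; have [] := sw_tree W_sw H s.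
have eta_surj m n : m != n -> exists nt, val (eta nt) = [fset m; n]%fset.
  move=> mn; have [h _ hK] := eta_bij.
  have card2 : #|` [fset m; n]%fset| == 2 by rewrite cardfs2 mn.
  by exists (h (exist (fun A : {fset nat} => #|` A| == 2) _ card2)); rewrite hK.
have total x n : exists k, `[< bound_set eta F n k x >].
  have [k xk] := bound_set_total treeF (bij_inj eta_bij) n x.
  by exists k; apply/asboolP.
(* Domination rests on [gP]; the choice of the least [k] makes the level sets of [g] the explicit
   Boolean combinations in [gE]. *)
pose g x n := ex_minn (total x n).
have gP x n : bound_set eta F n (g x n) x.
  by rewrite /g; case: ex_minnP => k /asboolP.
have gE n k : [set x | g x n = k] =
    bound_set eta F n k `&` \bigcap_(i < k) ~` bound_set eta F n i.
  apply/seteqP; split=> x /=; rewrite /g; case: ex_minnP => l /asboolP xl lmin.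
    by move=> <-; split=> // i /= il xi; have := lmin i (asboolT xi); rewrite leqNgt il.
  move=> [xk xi]; apply/eqP; rewrite eqn_leq lmin ?asboolT//= leqNgt.
  by apply/negP => lk; apply: (xi l lk).
have [c cP Mc] := borel_family_in_M M_ZF
  (borel_family_first M_ZF (borel_family_bound M_ZF W_M)).
exists g; split.
- by apply: borel_fun_eval => n k; rewrite gE; apply: borel_code_borel (cP n k).
- by exists c => // n k; rewrite gE; exact: cP.
apply: (bound_dominates treeF (sw_cover W_sw) eta_surj) => //.
move=> nt n1 n2 H s1 s2; have /= [A|[x [_ _ A B]]|A] := sw_disjoint W_sw H s1 s2.
- exact: Or31.
- by apply: Or32; exists x.
- exact: Or33.
Qed.
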